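(* Let $(\mathcal A,\varphi)$ be a non-commutative probability space, let $(a_1,b_1)$ and $(a_2,b_2)$ be bi-free pairs in $(\mathcal A,\varphi)$ such that $\varphi(a_jb_j)\neq\varphi(a_j)\varphi(b_j)$ and $\varphi(a_j)\ne0\ne\varphi(b_j)$ for $j=1,2$, and let $X_j=\begin{pmatrix}a_j&0\\0&b_j\end{pmatrix}\in M_2(\mathcal A)$. Then the functions $S_{X_1X_2}(\Gamma)$ and $S_{X_2}(\Gamma)S_{X_1}(S_{X_2}(\Gamma)^{-1}\Gamma S_{X_2}(\Gamma))$ of the invertible upper triangular matrix $\Gamma\in M_2(\mathbb C)$ do not coincide in any neighborhood of the zero matrix; that is, for every $\varepsilon>0$ (small enough that both sides are defined for $\|\Gamma\|<\varepsilon$) there is an invertible upper triangular $\Gamma$ with $\|\Gamma\|<\varepsilon$ and $$S_{X_1X_2}(\Gamma)\neq S_{X_2}(\Gamma)\,S_{X_1}\big(S_{X_2}(\Gamma)^{-1}\Gamma S_{X_2}(\Gamma)\big).$$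
   Context: $\mathcal A$ is a von Neumann algebra and $\varphi$ is a state on it. $E:M_2(\mathcal A)\to M_2(\mathbb C)$ is $E((x_{ij}))=(\varphi(x_{ij}))$. Matrix-valued transforms. For $X=\begin{pmatrix}a&0\\0&b\end{pmatrix}$ with $\varphi(a)\neq0\neq\varphi(b)$ and upper triangular $\Gamma=\begin{pmatrix}z&\zeta\\0&w\end{pmatrix}\in M_2(\mathbb C)$ with $|z|,|w|$ small, $\Psi_X(\Gamma)=E((1-\Gamma X)^{-1})-1$, which is again upper triangular. $\Psi_X^{\langle-1\rangle}$ denotes the inverse under composition of $\Psi_X$ restricted to upper triangular matrices, defined for $|z|,|w|$ small (any $\zeta\in\mathbb C$). For invertible such $\Gamma$, $S_X(\Gamma)=\Gamma^{-1}(1+\Gamma)\Psi_X^{\langle-1\rangle}(\Gamma)$. Note $X_1X_2=\begin{pmatrix}a_1a_2&0\\0&b_1b_2\end{pmatrix}$. Bi-freeness (Voiculescu). A vector space with specified state vector is a triple $(\mathcal X,\mathcal X^\circ,\xi)$ with $\mathcal X=\mathbb C\xi\oplus\mathcal X^\circ$. Given two such triples $(\mathcal X_i,\mathcal X_i^\circ,\xi_i)$, $i=1,2$, their free product is $\mathcal X=\mathbb C\xi\oplus\bigoplus_{n\ge1}\bigoplus_{i_1\ne i_2\ne\cdots\ne i_n}\mathcal X_{i_1}^\circ\otimes\cdots\otimes\mathcal X_{i_n}^\circ$, with functional $\psi:\mathcal X\to\mathbb C$ given by $\psi(\xi)=1$ and $\psi=0$ on the other summands. Let $\mathcal X(\ell,i)$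 (resp. $\mathcal X(r,i)$) be the span of $\xi$ and the summands with $i_1\neq i$ (resp. $i_n\ne i$). There are natural identifications $V_i:\mathcal X_i\otimes\mathcal X(\ell,i)\to\mathcal X$ and $W_i:\mathcal X(r,i)\otimes\mathcal X_i\to\mathcal X$ (concatenation of tensors, with $\xi_i$ and $\xi$ acting as empty words), and for a linear operator $T$ on $\mathcal X_i$ one sets $\lambda_i(T)=V_i(T\otimes I)V_i^{-1}$ and $\rho_i(T)=W_i(I\otimes T)W_i^{-1}$. The pairs $(a_1,b_1)$, $(a_2,b_2)$ in $(\mathcal A,\varphi)$ (the $a_i$ being left variables and the $b_i$ right variables) are bi-free if there exist such triples and linear operators $T_i,S_i$ on $\mathcal X_i$ with $\varphi(P(a_1,b_1,a_2,b_2))=\psi(P(\lambda_1(T_1),\rho_1(S_1),\lambda_2(T_2),\rho_2(S_2))\xi)$ for every non-commutative polynomial $P$ in four variables. *)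

(* Defs.v *)
From HB Require Import structures.
From mathcomp Require Import all_boot all_order all_algebra.
From mathcomp Require Import all_classical all_reals all_analysis.
From mathcomp Require Import complex.
Set Implicit Arguments.
Unset Strict Implicit.
Unset Printing Implicit Defensive.
Import Order.TTheory GRing.Theory Num.Theory.
Import numFieldNormedType.Exports.
Local Open Scope classical_set_scope.
Local Open Scope ring_scope.
Local Open Scope complex_scope.

(* The inner product is linear in its first argument. *)
Definition inner_norm (R : realType) (H : lmodType R[i])
    (ip : H -> H -> R[i]) (x : H) : R :=
  Num.sqrt (complex.Re (ip x x)).

Record hilbertSpace (R : realType) := HilbertSpace {
  hilbert_car :> lmodType R[i];
  inner : {dot hilbert_car for Num.conj};
  hilbert_complete : forall u : nat -> hilbert_car,
    (forall e : R, 0 < e -> exists N, forall m n, (N <= m)%N -> (N <= n)%N ->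
       inner_norm inner (u m - u n) < e) ->
    exists l, forall e : R, 0 < e -> exists N, forall n, (N <= n)%N ->
       inner_norm inner (u n - l) < e }.

Section Operators.
Variables (R : realType) (H : hilbertSpace R).

Definition hnorm (x : H) : R := inner_norm (@inner R H) x.

Definition bounded_op (T : H -> H) : Prop :=
  linear T /\ exists K : R, forall x, hnorm (T x) <= K * hnorm x.

Definition op_norm (T : H -> H) : R :=
  inf [set K : R | 0 <= K /\ forall x, hnorm (T x) <= K * hnorm x].

Definition adjoint_of (T S : H -> H) : Prop :=
  forall x y, inner H (T x) y = inner H x (S y).

Definition commutant (M : set (H -> H)) : set (H -> H) :=
  [set T | bounded_op T /\ forall S, M S -> T \o S = S \o T].

(* The elements of B(H) are the functions satisfying [bounded_op]. *)
Definition von_neumann_algebra (M : set (H -> H)) : Prop :=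
  [/\ M `<=` bounded_op,
      (forall T S, M T -> bounded_op S -> adjoint_of T S -> M S)
    & commutant (commutant M) = M].

(* [rep] identifies the abstract unital algebra [A] with a von Neumann algebra
   of operators on [H]; working with [A] gives access to the rings ['M[A]_n]. *)
Definition von_neumann_rep (A : algType R[i]) (rep : A -> H -> H) : Prop :=
  [/\ (forall c a b x, rep (c *: a + b) x = c *: rep a x + rep b x),
      rep 1 = id,
      (forall a b, rep (a * b) = rep a \o rep b),
      injective rep
    & von_neumann_algebra (range rep)].

(* A positive functional of norm one, the norm being attained at the unit. *)
Definition is_state (A : algType R[i]) (rep : A -> H -> H)
    (phi : {scalar A}) : Prop :=
  [/\ (forall a s, adjoint_of (rep a) (rep s) -> 0 <= phi (s * a)),
      (forall a, `|phi a| <= (op_norm (rep a))%:C)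
    & phi 1 = 1].

End Operators.

(* A triple (X_i, X_i^o, xi_i) is given by the vector space [V i] = X_i^o: then
   X_i is the direct sum [C^o * V i], in which xi_i = (1, 0).
   A word x_1 ... x_n, with letters in the X_i^o tagged by their index,
   stands for a simple tensor. *)
Section FreeProduct.
Variables (C : fieldType) (I : eqType) (V : I -> lmodType C).

Definition pointed_space (i : I) : lmodType C := (C^o * V i)%type.

Definition letter := {i : I & V i}.
Definition word := seq letter.
Definition mkletter (i : I) (x : V i) : letter := existT _ i x.

Definition alternating (w : word) : bool :=
  sorted (fun x y : letter => tag x != tag y) w.

(* A family of multilinear forms, one on each product
   X_{i_1}^o x ... x X_{i_n}^o with i_1 <> i_2 <> ... <> i_n. *)
Definition multilinear (f : word -> C) : Prop :=
  forall (u v : word) (i : I) (x y : V i) (c : C),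
    alternating (u ++ mkletter x :: v) ->
    f (u ++ mkletter (c *: x + y) :: v) =
    c * f (u ++ mkletter x :: v) + f (u ++ mkletter y :: v).

Definition mform := {f : word -> C | multilinear f}.

(* The algebraic tensor product of vector spaces over a field is realized as
   the span of the evaluations f |-> f (x_1, ..., x_n) inside the linear
   functionals on the multilinear forms.  Doing so for all the shapes of
   alternating words at once yields the direct sum of the tensor products. *)
Definition ev (w : word) : mform -> C^o := fun f => sval f w.

Definition spanned (g : mform -> C^o) : Prop :=
  exists2 s : seq (C * word), all (fun p => alternating p.2) s
                            & g = \sum_(p <- s) p.1 *: ev p.2.

Definition free_pred : pred (mform -> C^o) := fun g => `[< spanned g >].

Lemma free_pred_submod : submod_closed free_pred.
Proof.
split; first by apply/asboolP; exists [::]; rewrite ?big_nil.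
move=> c g h /asboolP[s sa ->] /asboolP[t ta ->]; apply/asboolP.
exists ([seq (c * p.1, p.2) | p <- s] ++ t).
  by rewrite all_cat ta andbT all_map.
rewrite big_cat big_map scaler_sumr; congr (_ + _).
by apply: eq_bigr => p _; rewrite scalerA.
Qed.

HB.instance Definition _ :=
  GRing.isSubmodClosed.Build C (mform -> C^o) free_pred free_pred_submod.

Record free_product := FreeProduct {
  free_val :> mform -> C^o;
  free_valP : free_val \in free_pred }.

HB.instance Definition _ := [isSub for free_val].
HB.instance Definition _ := [Choice of free_product by <:].
HB.instance Definition _ :=
  [SubChoice_isSubLmodule of free_product by <:].


(* The vector x_1 (x) ... (x) x_n for an alternating word, xi for [::]. *)
Definition tens (w : word) : free_product := insubd 0 (ev w).

(* X(l, i) is spanned by the words satisfying [in_left i], X(r, i) by those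
   satisfying [in_right i]. *)
Definition in_left (i : I) (w : word) : bool :=
  alternating w && (if w is x :: _ then tag x != i else true).

Definition in_right (i : I) (w : word) : bool :=
  alternating w && (if rev w is x :: _ then tag x != i else true).

(* V_i (x (x) w) and W_i (w (x) x), for x in X_i. *)
Definition Vmap (i : I) (x : pointed_space i) (w : word) : free_product :=
  x.1 *: tens w + tens (mkletter x.2 :: w).

Definition Wmap (i : I) (w : word) (x : pointed_space i) : free_product :=
  x.1 *: tens w + tens (rcons w (mkletter x.2)).

(* L V_i = V_i (T (x) I) and L W_i = W_i (I (x) T), on simple tensors. *)
Definition is_lambda (i : I) (T : pointed_space i -> pointed_space i)
    (L : free_product -> free_product) : Prop :=
  linear L /\
  forall x w, in_left i w -> L (Vmap x w) = Vmap (T x) w.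

Definition is_rho (i : I) (T : pointed_space i -> pointed_space i)
    (L : free_product -> free_product) : Prop :=
  linear L /\
  forall x w, in_right i w -> L (Wmap w x) = Wmap w (T x).

Lemma tensE w f : alternating w -> tens w f = sval f w.
Proof.
move=> aw; have -> : free_val (tens w) = ev w; last by [].
rewrite /tens -[free_val _]/(val _) insubdK//; apply/asboolP.
by exists [:: (1, w)]; rewrite /= ?aw// big_seq1 scale1r.
Qed.

Lemma free_eq (g h : free_product) : (forall f, g f = h f) -> g = h.
Proof. by move=> gh; apply: val_inj; apply/funext => f; exact: gh. Qed.

Lemma freeD (g h : free_product) f : (g + h) f = g f + h f.
Proof. by []. Qed.

Lemma freeZ c (g : free_product) f : (c *: g) f = c * g f.
Proof. by []. Qed.

Lemma transposeP (F : mform -> mform) :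
  (forall w, alternating w -> spanned (fun f => ev w (F f))) ->
  exists L : free_product -> free_product,
    linear L /\ forall g f, L g f = g (F f).
Proof.
move=> FP.
have spF (g : free_product) : (fun f => g (F f)) \in free_pred.
  case: g => g /= /asboolP[s sa ->]; elim: s sa => [|p s IH] /=.
    move=> _; rewrite [X in X \in _](_ : _ = 0) ?rpred0//.
    by apply/funext => f; rewrite big_nil.
  move=> /andP[pa /IH sF].
  rewrite [X in X \in _](_ : _ = p.1 *: (fun f => ev p.2 (F f)) +
      (fun f => (\sum_(p <- s) p.1 *: ev p.2) (F f))); last first.
    by apply/funext => f; rewrite big_cons.
  by rewrite rpredD// rpredZ//; apply/asboolP; exact: FP.
exists (fun g => FreeProduct (spF g)); split=> // c g h.
exact: free_eq.
Qed.

Lemma multilinear_rev (f : mform) : multilinear (fun w => sval f (rev w)).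
Proof.
move=> u v i x y c; rewrite !rev_cat !rev_cons !cat_rcons => a.
apply: (svalP f); rewrite -cat_rcons -rev_cons -rev_cat /alternating rev_sorted.
rewrite (@eq_sorted _ _ (fun x y : letter => tag x != tag y))//.
by move=> ? ?; rewrite eq_sym.
Qed.

Lemma alternating_rev w : alternating (rev w) = alternating w.
Proof.
rewrite /alternating rev_sorted; apply: eq_sorted => ? ?.
by rewrite eq_sym.
Qed.

Definition rev_form (f : mform) : mform := exist _ _ (multilinear_rev f).

Lemma reversal : exists L : free_product -> free_product,
  linear L /\ forall w, alternating w -> L (tens w) = tens (rev w).
Proof.
have [|L [Ll LE]] := @transposeP rev_form.
  move=> w aw; exists [:: (1, rev w)]; first by rewrite /= alternating_rev aw.
  by rewrite big_seq1 scale1r.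
exists L; split=> // w aw; apply: free_eq => f.
by rewrite LE !tensE// alternating_rev.
Qed.

Section LambdaRho.
Variables (i : I) (T : {linear pointed_space i -> pointed_space i}).

Definition lact (f : word -> C) (w : word) : C :=
  let: q := T (1, 0) in
  let: d := q.1 * f w + f (mkletter q.2 :: w) in
  if w is u :: w' then
    untag d (fun x : V i => let: p := T (0, x) in
                            p.1 * f w' + f (mkletter p.2 :: w')) u
  else d.

Lemma alternating_cons (x : letter) (w : word) :
  alternating (x :: w) =
  alternating w && (if w is y :: _ then tag x != tag y else true).
Proof. by case: w => //= y w; rewrite andbC. Qed.

Lemma alternating_tag (u v : word) j (x y : V j) :
  alternating (u ++ mkletter x :: v) = alternating (u ++ mkletter y :: v).
Proof.
elim: u => [|t [|t' u] IH] /=; first by case: v.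
  by case: v {IH}.
by move: IH => /= ->.
Qed.

Lemma lact_dflt f w : in_left i w ->
  lact f w = (T (1, 0)).1 * f w + f (mkletter (T (1, 0)).2 :: w).
Proof. by case: w => //= u w /andP[_ ui]; rewrite untag_dflt. Qed.

Lemma lact_cons f x w :
  lact f (mkletter x :: w) =
  (T (0, x)).1 * f w + f (mkletter (T (0, x)).2 :: w).
Proof. by rewrite /= (untagE _ _ (erefl : tag (mkletter x) = i)). Qed.

Arguments lact : simpl never.

Lemma in_leftE w : in_left i w = alternating w && alternating (mkletter (0 : V i) :: w).
Proof.
rewrite /in_left; case: w => //= u w; rewrite [i == _]eq_sym.
by case: path; rewrite ?andbT ?andbF.
Qed.

Lemma in_left_alt w (x : V i) : in_left i w -> alternating (mkletter x :: w).
Proof.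
rewrite in_leftE => /andP[_].
by rewrite -[_ :: w]cat0s -[X in _ -> is_true (alternating X)]cat0s
   (alternating_tag _ _ 0 x).
Qed.

Lemma in_left_tag u v j (x y : V j) :
  in_left i (u ++ mkletter x :: v) = in_left i (u ++ mkletter y :: v).
Proof.
by rewrite !in_leftE (alternating_tag u v x y) -!cat_cons
   (alternating_tag _ v x y).
Qed.

Lemma multilinear_lact (f : mform) : multilinear (lact (sval f)).
Proof.
have fM := svalP f.
have dflt u v j (x y : V j) c : in_left i (u ++ mkletter x :: v) ->
    lact (sval f) (u ++ mkletter (c *: x + y) :: v) =
    c * lact (sval f) (u ++ mkletter x :: v) +
    lact (sval f) (u ++ mkletter y :: v).
  move=> il; rewrite !lact_dflt//; last first.
  - by rewrite (in_left_tag u v _ x).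
  - by rewrite (in_left_tag u v _ x).
  have /andP[al _] := il; rewrite fM// -!cat_cons fM; last first.
    by rewrite cat_cons in_left_alt.
  by rewrite !mulrDr (mulrCA _ c) addrACA.
move=> u v j x y c a; have [/dflt->//|] := boolP (in_left i (u ++ mkletter x :: v)).
case: u a => [|t u] a; rewrite /in_left a /= negbK => /eqP ti.
  subst j; rewrite !lact_cons.
  have -> : ((0, c *: x + y) : pointed_space i) = c *: (0, x) + (0, y).
    by congr (_, _); rewrite /= scaler0 addr0.
  rewrite linearP /=; set p := T _; set q := T _.
  have al (z : V i) : alternating (mkletter z :: v).
    exact: etrans (alternating_tag [::] v z x) a.
  rewrite [X in _ + X = _](fM [::]); last exact: al.
  by rewrite -[c *: p.1]/(c * p.1) mulrDl mulrDr !mulrA addrACA.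
case: t ti a => k t ti; have {}ti : k = i := ti; subst k => a.
rewrite -/(mkletter t) !cat_cons !lact_cons in a *.
have al : alternating (u ++ mkletter x :: v).
  by move: a; rewrite alternating_cons => /andP[].
rewrite fM// -!cat_cons fM; last first.
  exact: etrans (alternating_tag [::] _ _ t) a.
by rewrite !mulrDr (mulrCA _ c) addrACA.
Qed.


Definition lact_form (f : mform) : mform := exist _ _ (multilinear_lact f).

Lemma lambda_exists : exists L, is_lambda T L.
Proof.
have [|L [Ll LE]] := @transposeP lact_form.
  move=> w aw.
  have [wi|] := boolP (in_left i w).
    exists [:: ((T (1, 0)).1, w); (1, mkletter (T (1, 0)).2 :: w)].
      by apply/and3P; split=> //; exact: in_left_alt.
    rewrite big_cons big_seq1 scale1r; apply/funext => f.
    by rewrite /ev /= lact_dflt.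
  case: w aw => [//|[k x] w] aw; rewrite /in_left aw negbK => /eqP ki.
  have {}ki : k = i := ki; subst k.
  have aw' : alternating w by move: aw; rewrite alternating_cons => /andP[].
  exists [:: ((T (0, x)).1, w); (1, mkletter (T (0, x)).2 :: w)].
    apply/and3P; split=> //.
    exact: etrans (alternating_tag [::] _ _ x) aw.
  rewrite big_cons big_seq1 scale1r; apply/funext => f.
  by rewrite /ev /= -/(mkletter x) lact_cons.
exists L; split=> // x w wi; apply: free_eq => f.
have aw : alternating w by case/andP: wi.
have axw (y : V i) : alternating (mkletter y :: w) by exact: in_left_alt.
have Tx : T x = x.1 *: T (1, 0) + T (0, x.2).
  rewrite -linearP; congr (T _); case: x => a y; congr (_, _) => /=.
    by rewrite addr0 -[_ *: _]/(_ * _) mulr1.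
  by rewrite scaler0 add0r.
rewrite LE /Vmap !freeD !freeZ !(tensE _ aw) !(tensE _ (axw _)).
rewrite /lact_form [sval _]/= lact_dflt// lact_cons Tx.
have /= -> := svalP f [::] w i (T (1, 0)).2 (T (0, x.2)).2 x.1 (axw _).
rewrite -[_ *: _]/(_ * _).
by rewrite mulrDr mulrDl !mulrA addrACA.
Qed.

End LambdaRho.

Lemma linear_tens_eq (L L' : free_product -> free_product) :
  linear L -> linear L' ->
  (forall w, alternating w -> L (tens w) = L' (tens w)) -> L = L'.
Proof.
move=> Ll Ll' LL'; apply/funext => g.
have L0 : L 0 = 0.
  by have := Ll (-1) 0 0; rewrite scaler0 addr0 scaleN1r addNr.
have L0' : L' 0 = 0.
  by have := Ll' (-1) 0 0; rewrite scaler0 addr0 scaleN1r addNr.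
have [s sa sE] : exists2 s : seq (C * word), all (fun p => alternating p.2) s
    & g = \sum_(p <- s) p.1 *: tens p.2.
  case: (g) => h /= hP; have /asboolP[s sa sE] := hP.
  exists s => //; apply: free_eq => f /=; rewrite sE.
  elim: s sa {sE} => [|p s IH] /=; first by rewrite !big_nil.
  move=> /andP[pa /IH IHs]; rewrite !big_cons freeD freeZ tensE// -IHs.
  by [].
rewrite {}sE; elim: s sa => [|p s IH] /=; first by rewrite big_nil L0 L0'.
by move=> /andP[pa /IH IHs]; rewrite big_cons Ll Ll' IHs LL'.
Qed.

Lemma is_lambda_inj i (T : pointed_space i -> pointed_space i) L L' :
  is_lambda T L -> is_lambda T L' -> L = L'.
Proof.
move=> [Ll LV] [Ll' LV']; apply: linear_tens_eq => // w aw.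
have tens0 v (x : V i) : in_left i v ->
    tens (mkletter x :: v) = Vmap ((0, x) : pointed_space i) v.
  by move=> vi; rewrite /Vmap scale0r add0r.
have [wi|] := boolP (in_left i w).
  have -> : tens w = Vmap ((1, 0) : pointed_space i) w; last by rewrite LV ?LV'.
  rewrite /Vmap scale1r.
  suff -> : tens (mkletter (0 : V i) :: w) = 0 by rewrite addr0.
  apply: free_eq => f; rewrite tensE ?in_left_alt//.
  have := svalP f [::] w i 0 0 (-1); rewrite scaler0 add0r => /=->//.
    by rewrite mulN1r addNr.
  exact: in_left_alt.
case: w aw => [//|[k x] w] aw; rewrite /in_left aw negbK => /eqP ki.
have {}ki : k = i := ki; subst k.
have wi : in_left i w.
  move: aw; rewrite alternating_cons /in_left => /andP[-> /=].
  by case: w => //= u w; rewrite eq_sym.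
by rewrite -/(mkletter x) tens0// LV ?LV'.
Qed.

Lemma rho_exists i (T : {linear pointed_space i -> pointed_space i}) :
  exists L, is_rho T L.
Proof.
have [L [Ll LV]] := lambda_exists T; have [J [Jl JE]] := reversal.
exists (J \o L \o J); split=> [c g h|x w]; first by rewrite /= Jl Ll Jl.
rewrite /in_right -alternating_rev => wi.
have aw : alternating (rev w) by case/andP: wi.
have axw (y : V i) : alternating (mkletter y :: rev w) by exact: in_left_alt.
have JV (y : pointed_space i) : J (Vmap y (rev w)) = Wmap w y.
  by rewrite /Vmap Jl (JE _ aw) (JE _ (axw _)) rev_cons revK.
have JW (y : pointed_space i) : J (Wmap w y) = Vmap y (rev w).
  have aw' : alternating w by rewrite -alternating_rev.
  have aw'' : alternating (rcons w (mkletter y.2)).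
    by rewrite -alternating_rev rev_rcons.
  by rewrite /Wmap Jl (JE _ aw') (JE _ aw'') rev_rcons.
by rewrite /= JW LV// JV.
Qed.

Lemma is_rho_inj i (T : pointed_space i -> pointed_space i) L L' :
  is_rho T L -> is_rho T L' -> L = L'.
Proof.
have [J [Jl JE]] := reversal.
have JK g : J (J g) = g.
  have Jl2 : linear (J \o J) by move=> c x y; rewrite /= !Jl.
  have := @linear_tens_eq _ id Jl2 (fun _ _ _ => erefl).
  move/(_ _) => JJ; suff: J \o J = id by move=> /(congr1 (@^~ g)).
  by apply: JJ => w aw; rewrite /= !JE ?alternating_rev// revK.
have JV (y : pointed_space i) w : in_left i w -> J (Vmap y w) = Wmap (rev w) y.
  move=> wi; have /andP[aw _] := wi.
  by rewrite /Vmap Jl (JE _ aw) (JE _ (in_left_alt _ wi)) rev_cons.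
have rhoJ M : is_rho T M -> is_lambda T (J \o M \o J).
  move=> [Ml MW]; split=> [c g h|x w wi]; first by rewrite /= Jl Ml Jl.
  rewrite /= JV// MW; last by rewrite /in_right revK alternating_rev.
  by rewrite -JV// JK.
move=> /rhoJ rL /rhoJ rL'; have LL' := is_lambda_inj rL rL'.
apply/funext => g; have /(congr1 (fun F => J (F (J g)))) /= := LL'.
by rewrite !JK.
Qed.

(* lambda_i(T) = V_i (T (x) I) V_i^-1 and rho_i(T) = W_i (I (x) T) W_i^-1. *)
Definition lambda i (T : {linear pointed_space i -> pointed_space i}) :
  free_product -> free_product := sval (cid (lambda_exists T)).

Definition rho i (T : {linear pointed_space i -> pointed_space i}) :
  free_product -> free_product := sval (cid (rho_exists T)).

Lemma lambdaP i (T : {linear pointed_space i -> pointed_space i}) :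
  is_lambda T (lambda T).
Proof. exact: svalP (cid (lambda_exists T)). Qed.

Lemma rhoP i (T : {linear pointed_space i -> pointed_space i}) :
  is_rho T (rho T).
Proof. exact: svalP (cid (rho_exists T)). Qed.

Lemma multilinear_nil : multilinear (fun w => (nilp w)%:R : C).
Proof. by move=> [|t u] v i x y c _; rewrite /= mulr0 addr0. Qed.

Definition xi : free_product := tens [::].

(* Evaluation at the form which is 1 on the empty word and 0 elsewhere. *)
Definition psi (g : free_product) : C := g (exist _ _ multilinear_nil).

Lemma psi_xi : psi xi = 1.
Proof. by rewrite /psi tensE. Qed.

Lemma psi_tens x w : alternating (x :: w) -> psi (tens (x :: w)) = 0.
Proof. by move=> axw; rewrite /psi tensE. Qed.

End FreeProduct.

(* Non-commutative polynomials with variables in [J], as lists of terms: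
   a coefficient and a word in the variables. *)
Definition ncpoly (C : Type) (J : Type) := seq (C * seq J).

Definition nceval (C : pzRingType) (J : Type) (A : algType C) (x : J -> A)
    (P : ncpoly C J) : A :=
  \sum_(p <- P) p.1 *: \prod_(j <- p.2) x j.

Definition ncact (C : pzRingType) (J : Type) (E : lmodType C) (x : J -> E -> E)
    (P : ncpoly C J) (v : E) : E :=
  \sum_(p <- P) p.1 *: foldr x v p.2.

(* The left variables are indexed by [inl i], the right ones by [inr i]. *)
Definition bifree (C : fieldType) (I : eqType) (A : algType C)
    (phi : A -> C) (a b : I -> A) : Prop :=
  exists (V : I -> lmodType C)
         (T S : forall i, {linear pointed_space V i -> pointed_space V i}),
  forall P : ncpoly C (I + I),
    phi (nceval (fun j => match j with inl i => a i | inr i => b i end) P) =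
    psi (ncact (fun j => match j with
                         | inl i => lambda (T i)
                         | inr i => rho (S i)
                         end) P (xi V)).

Section Transforms.
Variables (R : realType) (A : algType R[i]) (phi : A -> R[i]).

(* The two-sided inverse in M_n(A) when it exists, and 0 otherwise: [invmx]
   requires a commutative ring of coefficients. *)
Definition mxinv n (M : 'M[A]_n) : 'M[A]_n :=
  xget 0 [set Y | Y *m M = 1%:M /\ M *m Y = 1%:M].

(* [is_trig_mx] is lower triangularity. *)
Definition upper_triangular (G : 'M[R[i]]_2) : bool := is_trig_mx G^T.

Definition Xmx (a b : A) : 'M[A]_2 :=
  diag_mx (\row_j if j == 0 then a else b).

Definition Psi (X : 'M[A]_2) (G : 'M[R[i]]_2) : 'M[R[i]]_2 :=
  map_mx phi (mxinv (1%:M - map_mx (in_alg A) G *m X)) - 1%:M.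

(* [K] inverts [F] under composition on the upper triangular matrices with
   small diagonal entries z, w and arbitrary entry zeta. *)
Definition comp_inverse_of (F K : 'M[R[i]]_2 -> 'M[R[i]]_2) : Prop :=
  exists2 d : R, 0 < d & forall G : 'M[R[i]]_2, upper_triangular G ->
    `|G 0 0| < d%:C -> `|G 1 1| < d%:C ->
    [/\ upper_triangular (K G), F (K G) = G & K (F G) = G].

(* Two inverses of [Psi X] in the sense above agree on the upper triangular
   matrices with small enough diagonal, so that the choice is immaterial. *)
Definition Psi_inv (X : 'M[A]_2) : 'M[R[i]]_2 -> 'M[R[i]]_2 :=
  xget (fun=> 0) [set K | comp_inverse_of (Psi X) K].

Definition S_transform (X : 'M[A]_2) (G : 'M[R[i]]_2) : 'M[R[i]]_2 :=
  invmx G *m (1%:M + G) *m Psi_inv X G.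

End Transforms.

(* Main.v *)
Require Import Defs.
From mathcomp Require Import all_boot all_order all_algebra.
From mathcomp Require Import all_classical all_reals all_analysis.
From mathcomp Require Import complex ring lra.
Set Implicit Arguments.
Unset Strict Implicit.
Unset Printing Implicit Defensive.
Import Order.TTheory GRing.Theory Num.Theory.
Import numFieldNormedType.Exports.
Import Normc.
Local Open Scope classical_set_scope.
Local Open Scope ring_scope.
Local Open Scope complex_scope.

(** Fix a pair (a, b) with phi a, phi b nonzero and put
      k = (phi (a b) - phi a phi b) / (phi a phi b).
    On the matrices with diagonal (z, z) and off-diagonal entry h, the matrix S_X is
    upper triangular with diagonal entries s (z), t (z) and off-diagonal entry
    h m (z), where s, t, m do not depend on h. As z tends to 0,
      t (z) -> 1 / phi b   and   m (z) -> - k / phi b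
    (S_transform_limit). Suppose that S_X0X1 = S_X1 S_X0 (S_X1^-1 G S_X1) on these
    matrices. Conjugating G by S_X1 multiplies its off-diagonal entry by t1 / s1, so
    comparing the off-diagonal entries gives
      m = t1 m0 + t0 m1
    for all small nonzero z, and in the limit k = k0 + k1, where k, k0, k1 belong to
    the pairs (a0 a1, b0 b1), (a0, b0), (a1, b1). Bi-freeness makes phi multiplicative
    on a0 a1 and on b0 b1 and gives phi (a0 a1 b0 b1) = phi (a0 b0) phi (a1 b1)
    (bifree_moments), that is 1 + k = (1 + k0) (1 + k1). Hence k0 k1 = 0, against the
    assumption that a_j and b_j are correlated under phi.

    The rest of the argument shows that S_X is the function just described. Since
    Psi_inv is a choice of a composition inverse, it has this meaning only if such an
    inverse exists. In the algebra, 1 - x has an inverse when x is small: it exists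
    among the bounded operators by the contraction principle, and it lies in the
    bicommutant (rep_resolvent). Then Psi_X is computed on upper triangular matrices
    (Psi_utri); its diagonal entries psi_a, psi_b have slopes phi a, phi b at 0 by the
    resolvent identity, so the contraction principle inverts them too, and its
    off-diagonal entry is linear in that of the argument (Psi_inv_utri). *)

(** * Contractions of complete groups *)

(** A complete group norm. It is what the contraction principle needs, and it covers
    both the modulus on R[i], with values in R, and the norm of a Hilbert space. *)
Definition complete_norm (R : realType) (V : zmodType) (N : V -> R) : Prop :=
  [/\ forall x y, N (x + y) <= N x + N y,
      forall x, N (- x) = N x,
      forall x, N x = 0 <-> x = 0
    & forall u : nat -> V,
        (forall e : R, 0 < e -> exists M, forall m n, (M <= m)%N -> (M <= n)%N ->
           N (u m - u n) < e) ->
        exists l, forall e : R, 0 < e -> exists M, forall n, (M <= n)%N ->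
           N (u n - l) < e].

Section FixedPoint.
Variables (R : realType) (V : zmodType) (N : V -> R).
Hypothesis NP : complete_norm N.

Lemma complete_norm_ge0 x : 0 <= N x.
Proof.
case: NP => ND NN _ _.
have := ND x (- x); have := ND 0 0; rewrite subrr addr0 NN; lra.
Qed.

(** The contraction principle on a ball. All the iterates u_n of 0 stay in the ball,
    so u_k is within 2r of u_0, and n applications of f bring u_(n+k) within
    2r / 2^n of u_n. *)
Lemma contraction_fixed_point (r : R) (f : V -> V) : 0 <= r ->
  (forall x, N x <= r -> N (f x) <= r) ->
  (forall x y, N x <= r -> N y <= r -> N (f x - f y) <= 2^-1 * N (x - y)) ->
  exists2 x, N x <= r & f x = x.
Proof.
case: (NP) => ND NN N0 cpl r0 fr fc.
have z0 : N 0 <= r by have /N0-> := erefl (0 : V).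
have N_ge0 := complete_norm_ge0.
pose u n := iter n f 0.
have ur n : N (u n) <= r by elim: n => //= n IH; exact: fr.
have dist n k : N (u (n + k)%N - u n) <= 2^-1 ^+ n * (2 * r).
  elim: n => [|n IH].
    rewrite expr0 mul1r; apply: le_trans (ND _ _) _; rewrite NN.
    have := ur k; have := ur 0; rewrite add0n; lra.
  rewrite addSn exprS -mulrA; apply: le_trans (fc _ _ (ur _) (ur _)) _.
  by rewrite ler_pM2l ?invr_gt0 ?ltr0n//; exact: IH.
have tail_small (e : R) : 0 < e -> exists M, 2^-1 ^+ M * (2 * r) < e.
  move=> e0; have : (fun n => (2 * r) * 2^-1 ^+ n) @ \oo --> (0 : R).
    by apply: cvg_geometric; rewrite ger0_norm; lra.
  move/cvgrPdist_lt => /(_ _ e0) [M _ /(_ M (leqnn M))] /=.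
  rewrite sub0r normrN ger0_norm; first by rewrite mulrC; exists M.
  by apply: mulr_ge0; [lra|apply: exprn_ge0; lra].
have distM M m n : (M <= m)%N -> (M <= n)%N ->
    N (u m - u n) <= 2 * (2^-1 ^+ M * (2 * r)).
  move=> Mm Mn; have := dist M (m - M)%N; have := dist M (n - M)%N.
  rewrite !subnKC//; have := ND (u m - u M) (u M - u n).
  by rewrite addrA subrK -[N (u M - u n)]NN opprB; lra.
have [e e0|l lP] := cpl u.
  have [M Me] := tail_small _ (divr_gt0 e0 (ltr0Sn _ 1)).
  exists M => m n Mm Mn; apply: le_lt_trans (distM _ _ _ Mm Mn) _.
  by move: Me; lra.
(* The ball is closed. *)
have lr : N l <= r.
  apply/ler_addgt0Pr => e e0; have [M MP] := lP _ e0.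
  have := MP M (leqnn M); rewrite -[N (u M - l)]NN opprB => ?.
  have := ND (l - u M) (u M); rewrite subrK.
  have := ur M; lra.
exists l => //; apply/eqP; rewrite -subr_eq0; apply/eqP/N0/le_anti.
rewrite N_ge0 andbT; apply/ler_addgt0Pr => e e0; rewrite add0r.
have [M MP] := lP _ (divr_gt0 e0 (ltr0Sn _ 1)).
have := ND (f l - u M.+1) (u M.+1 - l); rewrite addrA subrK.
have := MP M.+1 (leqnSn M); have := MP M (leqnn M).
have : N (f l - u M.+1) <= 2^-1 * N (l - u M) by exact: fc.
rewrite -[N (u M - l)]NN opprB; lra.
Qed.

End FixedPoint.

(** * The modulus of complex numbers *)

Section ComplexModulus.
Variable R : realType.

Lemma normcE_real (z : R[i]) : `|z| = (normc z)%:C. Proof. by []. Qed.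

Lemma normc_ge0 (z : R[i]) : 0 <= normc z.
Proof. by case: z => x y; exact: sqrtr_ge0. Qed.

Lemma normc_gt0 (z : R[i]) : z != 0 -> 0 < normc z.
Proof.
by move=> z0; rewrite lt_def normc_ge0 andbT; apply: contra z0 => /eqP/eq0_normc->.
Qed.

Lemma normc_leReIm (z : R[i]) : normc z <= `|complex.Re z| + `|complex.Im z|.
Proof.
case: z => x y /=; rewrite -[leRHS]ger0_norm ?addr_ge0// -sqrtr_sqr.
apply: ler_wsqrtr; rewrite sqrrD !real_normK ?num_real//.
have : 0 <= `|x| * `|y| by rewrite mulr_ge0.
rewrite mulr2n; lra.
Qed.

Lemma Re_le_normc (z : R[i]) : `|complex.Re z| <= normc z.
Proof.
case: z => x y /=; rewrite -sqrtr_sqr; apply: ler_wsqrtr.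
by rewrite lerDl sqr_ge0.
Qed.

Lemma Im_le_normc (z : R[i]) : `|complex.Im z| <= normc z.
Proof.
case: z => x y /=; rewrite -sqrtr_sqr; apply: ler_wsqrtr.
by rewrite lerDr sqr_ge0.
Qed.

Lemma real_complete (u : nat -> R) :
  (forall e : R, 0 < e -> exists M, forall m n, (M <= m)%N -> (M <= n)%N ->
     `|u m - u n| < e) ->
  exists l, forall e : R, 0 < e -> exists M, forall n, (M <= n)%N ->
     `|u n - l| < e.
Proof.
move=> uC; have : cvg (u @ \oo).
  apply/cauchy_cvgP/cauchy_exP => e e0; have [M MP] := uC _ e0.
  by exists (u M); exists M => // n /= Mn; exact: MP.
move=> /cvgrPdist_lt ul; exists (limn u) => e /ul [M _ MP].
by exists M => n Mn; rewrite distrC; exact: MP.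
Qed.

(** A sequence of complex numbers is Cauchy as soon as its real and imaginary parts
    are, which reduces completeness to that of R. *)
Lemma normc_complete : complete_norm (@normc R).
Proof.
split; [exact: le_normcD|exact: normcN| |move=> u uC].
  by split=> [/eq0_normc|->]; rewrite ?normc0.
have [e e0|x xP] := @real_complete (fun n => complex.Re (u n)).
  have [M MP] := uC _ e0; exists M => m n Mm Mn.
  apply: le_lt_trans (MP _ _ Mm Mn); apply: le_trans (Re_le_normc _).
  by rewrite raddfB.
have [e e0|y yP] := @real_complete (fun n => complex.Im (u n)).
  have [M MP] := uC _ e0; exists M => m n Mm Mn.
  apply: le_lt_trans (MP _ _ Mm Mn); apply: le_trans (Im_le_normc _).
  by rewrite raddfB.
exists (x +i* y) => e e0.
have [M1 M1P] := xP _ (divr_gt0 e0 (ltr0Sn _ 1)).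
have [M2 M2P] := yP _ (divr_gt0 e0 (ltr0Sn _ 1)).
exists (maxn M1 M2) => n; rewrite geq_max => /andP[/M1P h1 /M2P h2].
apply: le_lt_trans (normc_leReIm _) _; rewrite !raddfB /=.
move: h1 h2; lra.
Qed.

End ComplexModulus.

(** * Hilbert spaces and bounded operators *)

Section HilbertNorm.
Variables (R : realType) (H : hilbertSpace R).
Local Notation "''[' u , v ]" := (inner H u v) : ring_scope.

Lemma hnorm_ge0 (x : H) : 0 <= hnorm x. Proof. exact: sqrtr_ge0. Qed.

Lemma hnorm_sqr (x : H) : '[x, x] = (hnorm x ^+ 2)%:C.
Proof.
have x0 : 0 <= '[x, x] by exact: dnorm_ge0.
have Re0 : 0 <= complex.Re '[x, x] by move: x0; rewrite lecE => /andP[].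
by rewrite sqr_sqrtr// RRe_real// ger0_real.
Qed.

Lemma hnormZ c (x : H) : hnorm (c *: x) = normc c * hnorm x.
Proof.
apply/eqP; rewrite -(eqrXn2 (n := 2)) ?mulr_ge0 ?hnorm_ge0 ?normc_ge0//.
apply/eqP; apply: complexI.
rewrite -hnorm_sqr exprMn rmorphM /= -hnorm_sqr dnormZ.
by rewrite rmorphXn.
Qed.

(** Write u = u1 + a v with u1 orthogonal to v: then <u, v> only sees a v, while
    |u|^2 = |u1|^2 + |a v|^2. *)
Lemma cauchy_schwarz (u v : H) : normc '[u, v] <= hnorm u * hnorm v.
Proof.
suff : `|'[u, v]| ^+ 2 <= '[u, u] * '[v, v].
  rewrite !hnorm_sqr normcE_real -rmorphXn -rmorphM lecR -exprMn.
  by rewrite ler_sqr ?nnegrE ?mulr_ge0 ?hnorm_ge0 ?normc_ge0.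
have [->|nz_v] := eqVneq v 0.
  by rewrite !(linear0r (inner H)) normr0 expr0n mulr0.
pose a := '[u, v] / '[v, v]; pose u1 := u - a *: v.
have v0 : '[v, v] != 0 by rewrite dnorm_eq0.
have ou : '[u1, v] = 0.
  by rewrite linearBl/= linearZl_LR/= divfK ?subrr.
have uE : u = u1 + a *: v by rewrite subrK.
rewrite {1}uE linearDl /= ou add0r linearZl_LR /= normrM.
rewrite (ger0_norm (dnorm_ge0 _ _)) exprMn.
rewrite (_ : _ ^+ 2 * _ = '[a *: v, a *: v] * '[v, v]); last first.
  by rewrite dnormZ; ring.
apply: ler_wpM2r; first exact: dnorm_ge0.
rewrite [leRHS](_ : _ = '[u1, u1] + '[a *: v, a *: v]); last first.
  by rewrite {1 2}uE hnormDd//= linearZr_LR/= ou mulr0.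
by rewrite lerDr dnorm_ge0.
Qed.

Lemma hnormD_le (u v : H) : hnorm (u + v) <= hnorm u + hnorm v.
Proof.
rewrite -(@ler_pXn2r _ 2)// ?nnegrE ?addr_ge0 ?hnorm_ge0//.
rewrite -lecR -hnorm_sqr dnormD !hnorm_sqr.
have := cauchy_schwarz u v; set d := '[u, v] => dP.
have -> : d + d^* = ((2 * complex.Re d)%:C : R[i]).
  by rewrite rmorphM rmorph_nat; exact: addcJ.
rewrite -!rmorphD/= lecR sqrrD.
have := Re_le_normc d; rewrite ler_norml => /andP[_ ?].
rewrite mulr2n; move: dP; nra.
Qed.

Lemma hnorm_opp (u : H) : hnorm (- u) = hnorm u.
Proof. by rewrite /hnorm /inner_norm hnormN. Qed.

Lemma hnorm_complete : complete_norm (@hnorm R H).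
Proof.
split; [exact: hnormD_le|exact: hnorm_opp| |exact: hilbert_complete].
move=> x; split=> [x0|->].
  by apply/eqP; rewrite -(dnorm_eq0 (inner H)) hnorm_sqr x0 expr0n.
by rewrite /hnorm /inner_norm linear0r sqrtr0.
Qed.

End HilbertNorm.

Section OperatorNorm.
Variables (R : realType) (H : hilbertSpace R).
Implicit Types T S Q : H -> H.

Lemma op_norm_le T K : 0 <= K -> (forall x, hnorm (T x) <= K * hnorm x) ->
  op_norm T <= K.
Proof.
by move=> K0 TK; apply: ge_inf => //; exists 0 => L [].
Qed.

Lemma op_norm_set_nonempty T : bounded_op T ->
  [set K : R | 0 <= K /\ forall x, hnorm (T x) <= K * hnorm x] !=set0.
Proof.
case=> _ [K TK]; exists `|K|; split=> // x; apply: le_trans (TK x) _.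
by rewrite ler_wpM2r ?hnorm_ge0// ler_norm.
Qed.

Lemma op_norm_ge0 T : bounded_op T -> 0 <= op_norm T.
Proof.
by move=> bT; apply: lb_le_inf; [exact: op_norm_set_nonempty|move=> K []].
Qed.

Lemma hnorm_op T x : bounded_op T -> hnorm (T x) <= op_norm T * hnorm x.
Proof.
move=> bT; have [x0|x0] := eqVneq (hnorm x) 0.
  by case: bT => _ [K /(_ x)]; rewrite x0 !mulr0.
have x_gt0 : 0 < hnorm x by rewrite lt_def x0 hnorm_ge0.
rewrite -ler_pdivrMr//; apply: lb_le_inf; first exact: op_norm_set_nonempty.
by move=> K [_ TK] /=; rewrite ler_pdivrMr.
Qed.

(** Solving y - T y = x means finding a fixed point of the contraction
    y |-> x + T y. Uniqueness of the solution makes the inverse Q linear; it is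
    also what later shows that Q commutes with everything that commutes with T. *)
Lemma neumann_inverse T : linear T ->
  (forall x, hnorm (T x) <= 2^-1 * hnorm x) ->
  exists Q, [/\ bounded_op Q, op_norm Q <= 2,
    (forall x, Q x - T (Q x) = x) & (forall x y, y - T y = x -> y = Q x)].
Proof.
move=> Tl Tle.
have [_ HN H0 _] := @hnorm_complete R H.
have TB u v : T (u - v) = T u - T v.
  by have := Tl (-1) v u; rewrite !scaleN1r ![- _ + _]addrC.
have fixT (x : H) : exists y, y - T y = x /\ hnorm y <= 2 * hnorm x.
  have r0 : 0 <= 2 * hnorm x by rewrite mulr_ge0 ?hnorm_ge0.
  have [y yr|y1 y2 _ _|y yr yE] :=
      contraction_fixed_point (hnorm_complete H) (f := fun y => x + T y) r0.
  - apply: le_trans (hnormD_le _ _) _; have := Tle y; move: yr; lra.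
  - by rewrite opprD addrACA subrr add0r -TB; exact: Tle.
  - by exists y; split=> //; rewrite -{1}yE addrK.
have [Q QP] := choice fixT.
have Quniq x y : y - T y = x -> y = Q x.
  move=> yx; apply/eqP; rewrite -subr_eq0; apply/eqP/H0.
  have := Tle (y - Q x).
  have -> : T (y - Q x) = y - Q x.
    have [/(canRL (subrK _)) QE _] := QP x.
    move/(canRL (subrK _)): yx => yE.
    by rewrite TB {2}yE {2}QE opprD addrACA subrr add0r.
  have := hnorm_ge0 (y - Q x); lra.
have Qb : forall x, hnorm (Q x) <= 2 * hnorm x by move=> x; case: (QP x).
exists Q; split; [split; last by exists 2| |by move=> x; case: (QP x)|by []].
  move=> c x y; apply/esym/Quniq; rewrite Tl opprD addrACA -scalerBr.
  by case: (QP x) => -> _; case: (QP y) => -> _.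
exact: op_norm_le.
Qed.

End OperatorNorm.

(** * Resolvents in a von Neumann algebra *)

(** What the transforms use of a von Neumann algebra and a state: 1 - x is invertible
    with a controlled inverse for small x, and phi is contractive for the norm. *)
Definition banach_functional (R : realType) (A : algType R[i]) (nrm : A -> R)
    (phi : {scalar A}) : Prop :=
  [/\ forall x, 0 <= nrm x,
      forall x y, nrm (x * y) <= nrm x * nrm y,
      forall c x, nrm (c *: x) <= normc c * nrm x,
      forall x, nrm x <= 2^-1 ->
        exists q, [/\ q * (1 - x) = 1, (1 - x) * q = 1 & nrm q <= 2]
    & (forall x, normc (phi x) <= nrm x) /\ phi 1 = 1].

Section VonNeumann.
Variables (R : realType) (H : hilbertSpace R) (A : algType R[i]).
Variable rep : A -> H -> H.
Hypothesis repP : von_neumann_rep rep.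

Lemma rep_bounded x : bounded_op (rep x).
Proof. by case: repP => _ _ _ _ [Mb _ _]; apply: Mb; exists x. Qed.

Lemma op_norm_repM x y :
  op_norm (rep (x * y)) <= op_norm (rep x) * op_norm (rep y).
Proof.
have [_ _ rM _ _] := repP; have bx := rep_bounded x; have b_y := rep_bounded y.
apply: op_norm_le => [|v]; first by rewrite mulr_ge0 ?op_norm_ge0.
rewrite rM /=; apply: le_trans (hnorm_op _ bx) _; rewrite -mulrA.
by rewrite ler_wpM2l ?op_norm_ge0// hnorm_op.
Qed.

Lemma op_norm_repZ c x : op_norm (rep (c *: x)) <= normc c * op_norm (rep x).
Proof.
have [rl _ _ _ _] := repP; have bx := rep_bounded x.
apply: op_norm_le => [|v]; first by rewrite mulr_ge0 ?normc_ge0 ?op_norm_ge0.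
have r0 : rep 0 v = 0.
  by have := rl (-1) 0 0 v; rewrite scaler0 addr0 scaleN1r addNr.
have := rl c x 0 v; rewrite r0 !addr0 => ->.
by rewrite hnormZ -mulrA ler_wpM2l ?normc_ge0// hnorm_op.
Qed.

(** The operator inverse of 1 - rep x commutes with the commutant of the algebra, so
    the bicommutant property puts it back into the algebra. *)
Lemma rep_resolvent x : op_norm (rep x) <= 2^-1 ->
  exists q, [/\ q * (1 - x) = 1, (1 - x) * q = 1 & op_norm (rep q) <= 2].
Proof.
move=> x12; have [rl r1 rM ri [Mb _ MM]] := repP; have bx := rep_bounded x.
have [||Q [bQ Q2 QT Quniq]] := @neumann_inverse R H (rep x).
- by case: bx.
- move=> v; apply: le_trans (hnorm_op v bx) _.
  by rewrite ler_wpM2r ?hnorm_ge0.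
have : range rep Q.
  rewrite -MM; split=> // S [[Sl _] SM]; apply/funext => v /=.
  apply/esym/Quniq.
  have /(congr1 (fun F => F (Q v))) /= <- := SM (rep x) (imageT _ _).
  have <- : S (Q v - rep x (Q v)) = S (Q v) - S (rep x (Q v)).
    by have := Sl (-1) (rep x (Q v)) (Q v); rewrite !scaleN1r ![- _ + _]addrC.
  by rewrite QT.
case=> q _ qQ; exists q; rewrite qQ; split=> //; apply: ri; rewrite rM qQ r1;
  apply/funext => v /=.
  apply/esym/Quniq; have := rl (-1) x 1 v; rewrite !scaleN1r ![- _ + _]addrC.
  by move=> ->; rewrite r1.
have := rl (-1) x 1 (Q v); rewrite !scaleN1r ![- _ + _]addrC => ->.
by rewrite r1 /= QT.
Qed.

Lemma state_banach_functional (phi : {scalar A}) : is_state rep phi ->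
  banach_functional (fun x => op_norm (rep x)) phi.
Proof.
case=> _ phin p1; split.
- by move=> x; exact: op_norm_ge0 (rep_bounded x).
- exact: op_norm_repM.
- exact: op_norm_repZ.
- exact: rep_resolvent.
- by split=> // x; have := phin x; rewrite normcE_real lecR.
Qed.

End VonNeumann.

(** * Limits and local inverses of functions of one complex variable *)

Lemma cvg_at0 (K : numFieldType) (f : K -> K) (l : K) :
  (forall e, 0 < e -> exists2 d, 0 < d & forall z, `|z| < d -> `|f z - l| < e) ->
  f z @[z --> (0 : K)] --> l.
Proof.
move=> fP; apply/(@cvgrPdist_lt _ _ _ (nbhs (0 : K))) => e /fP[d d0 fd].
by apply: filterS (@nbhs0_lt K K d d0) => z /fd; rewrite distrC.
Qed.

Lemma cvg0M (K : numFieldType) (f g : K -> K) (x y : K) :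
  f z @[z --> (0 : K)] --> x -> g z @[z --> (0 : K)] --> y ->
  (f z * g z) @[z --> (0 : K)] --> x * y.
Proof. exact: (@cvgM K K (nbhs (0 : K)) _ f g x y). Qed.

Lemma cvg0D (K : numFieldType) (f g : K -> K) (x y : K) :
  f z @[z --> (0 : K)] --> x -> g z @[z --> (0 : K)] --> y ->
  (f z + g z) @[z --> (0 : K)] --> x + y.
Proof. exact: (@cvgD K K K (nbhs (0 : K)) _ f g x y). Qed.

Lemma cvg0B (K : numFieldType) (f g : K -> K) (x y : K) :
  f z @[z --> (0 : K)] --> x -> g z @[z --> (0 : K)] --> y ->
  (f z - g z) @[z --> (0 : K)] --> x - y.
Proof. exact: (@cvgB K K K (nbhs (0 : K)) _ f g x y). Qed.

Lemma cvg0V (K : numFieldType) (f : K -> K) (x : K) : x != 0 ->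
  f z @[z --> (0 : K)] --> x -> (f z)^-1 @[z --> (0 : K)] --> x^-1.
Proof. exact: (@cvgV K K (nbhs (0 : K)) _ f x). Qed.

(** The entries of the S-transform on the matrices with diagonal (z, z), in the form
    given to them by S_transform_limit. *)
Lemma S_entries_cvg (K : numFieldType) (p ga gb h m : K -> K) (al be mu : K) :
  al != 0 -> be != 0 ->
  p z @[z --> (0 : K)] --> (1 : K) -> ga z @[z --> (0 : K)] --> al ->
  gb z @[z --> (0 : K)] --> be -> h z @[z --> (0 : K)] --> be ->
  m z @[z --> (0 : K)] --> mu ->
  [/\ (p z / ga z) @[z --> (0 : K)] --> al^-1,
      ((ga z * gb z - m z) / (ga z * h z * gb z)) @[z --> (0 : K)] -->
        (al * be - mu) / (al * be * be)
    & (p z / gb z) @[z --> (0 : K)] --> be^-1].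
Proof.
move=> al0 be0 cp ca cb ch cm; split.
- by rewrite -[X in _ --> X]mul1r; apply: (cvg0M cp); exact: cvg0V.
- apply: cvg0M; first by apply: (cvg0B _ cm); exact: cvg0M.
  apply: cvg0V; first by rewrite !mulf_neq0.
  by apply: (cvg0M _ cb); exact: cvg0M.
- by rewrite -[X in _ --> X]mul1r; apply: (cvg0M cp); exact: cvg0V.
Qed.

Lemma cvg_punctured_eq (K : numFieldType) (f g : K -> K) (x y d : K) :
  f z @[z --> (0 : K)] --> x -> g z @[z --> (0 : K)] --> y -> 0 < d ->
  (forall z, z != 0 -> `|z| < d -> f z = g z) -> x = y.
Proof.
move=> fx gy d0 fg; apply/eqP; rewrite -subr_eq0; apply/negP => /negP xy.
have fgxy := cvg0B fx gy.
have e0 : 0 < `|x - y| by rewrite normr_gt0.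
have near0 : nbhs (0 : K) [set z | `|x - y - (f z - g z)| < `|x - y|].
  by have /(@cvgrPdist_lt _ _ _ (nbhs (0 : K))) := fgxy; exact.
have [z [[/= hz z0] zd]] := filter_ex (filterI (filterI (nbhs_dnbhs near0)
  (nbhs_dnbhs_neq (0 : K))) (@dnbhs0_lt K K d d0)).
by move: hz; rewrite fg ?z0// subrr subr0 ltxx.
Qed.

(** The form taken by the off-diagonal entry of the product S_X1 S_X0. *)
Lemma cvg_relation (K : numFieldType) (f f0 f1 g0 g1 : K -> K)
    (x x0 x1 y0 y1 d : K) :
  f z @[z --> (0 : K)] --> x ->
  f0 z @[z --> (0 : K)] --> x0 -> f1 z @[z --> (0 : K)] --> x1 ->
  g0 z @[z --> (0 : K)] --> y0 -> g1 z @[z --> (0 : K)] --> y1 -> 0 < d ->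
  (forall z, z != 0 -> `|z| < d -> f z = g1 z * f0 z + g0 z * f1 z) ->
  x = y1 * x0 + y0 * x1.
Proof.
move=> fx fx0 fx1 gy0 gy1; apply: cvg_punctured_eq fx _.
exact: cvg0D (cvg0M gy1 fx0) (cvg0M gy0 fx1).
Qed.

Lemma scale_small (K : numFieldType) m n (M : 'M[K]_(m.+1, n.+1)) (e : K) :
  0 < e -> exists2 d, 0 < d & forall z, `|z| < d -> `|z *: M| < e.
Proof.
move=> e0; have M1 : 0 < `|M| + 1 by rewrite ltr_wpDl.
exists (e / (`|M| + 1)); first by rewrite divr_gt0.
move=> z; rewrite ltr_pdivlMr// normrZ; apply: le_lt_trans.
by rewrite ler_wpM2l// lerDl.
Qed.

Section LocalInverse.
Variable R : realType.
Local Notation C := R[i].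

(** A quantitative inverse function theorem: when f is linear with slope c up to a
    relative error 1/2 on the ball of radius r, solving f z = y is finding a fixed
    point of the contraction z |-> z - (f z - y) / c. Both inverse laws are stated
    with explicit radii, because inverting Psi needs the two scalar inverses on one
    common disc. *)
Lemma local_inverse (f : C -> C) (c : C) (r : R) :
  c != 0 -> 0 <= r -> f 0 = 0 ->
  (forall z w, normc z <= r -> normc w <= r ->
     normc (f z - f w - c * (z - w)) <= normc c / 2 * normc (z - w)) ->
  exists g : C -> C,
    (forall y, normc y <= normc c * r / 2 ->
       f (g y) = y /\ normc (g y) <= 2 * normc y / normc c) /\
    (forall z, normc z <= r -> normc (f z) <= normc c * r / 2 -> g (f z) = z).
Proof.
move=> c0 r0 f0 fP.
have [ND NN N0 _] := normc_complete R.
have nc0 : 0 < normc c.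
  by rewrite lt_def normc_ge0 andbT; apply: contra c0 => /eqP/N0->.
have nz0 : normc (0 : C) = 0 by exact: normc0.
have lower z w : normc z <= r -> normc w <= r ->
    normc c / 2 * normc (z - w) <= normc (f z - f w).
  move=> zr wr; have := fP z w zr wr.
  have := ND (f z - f w) (- (f z - f w - c * (z - w))).
  by rewrite NN opprB addrCA subrr addr0 normcM; lra.
have solve y : exists z, normc y <= normc c * r / 2 -> f z = y /\ normc z <= r.
  have [yr|/negP ny] := boolP (normc y <= normc c * r / 2); last by exists 0.
  pose T z := z - c^-1 * (f z - y).
  have TB z w : T z - T w = - c^-1 * (f z - f w - c * (z - w)).
    by rewrite /T; field.
  have Tc z w : normc z <= r -> normc w <= r ->
      normc (T z - T w) <= 2^-1 * normc (z - w).
    move=> zr wr; rewrite TB normcM NN normcV mulrC ler_pdivrMr//.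
    by have := fP z w zr wr; lra.
  have Tr z : normc z <= r -> normc (T z) <= r.
    move=> zr; have := ND (T z - T 0) (T 0); rewrite subrK.
    have := Tc z 0 zr; rewrite nz0 subr0 => /(_ r0).
    have : normc (T 0) <= r / 2.
      rewrite /T f0 !sub0r mulrN opprK normcM normcV mulrC ler_pdivrMr//; lra.
    lra.
  have [z zr zE] := contraction_fixed_point (normc_complete R) r0 Tr Tc.
  exists z => _; split=> //; apply/eqP; rewrite -subr_eq0.
  move/eqP: zE; rewrite /T -subr_eq0 addrAC subrr add0r oppr_eq0 mulf_eq0.
  by rewrite invr_eq0 (negPf c0).
have [g gP] := choice solve.
exists g; split=> [y yr|z zr fzr].
  have [fg gr] := gP y yr; split=> //.
  have := lower (g y) 0 gr; rewrite nz0 f0 !subr0 fg => /(_ r0).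
  by rewrite ler_pdivlMr//; lra.
have [fg gr] := gP _ fzr; apply/eqP; rewrite -subr_eq0; apply/eqP/N0/le_anti.
rewrite normc_ge0 andbT; have := lower _ _ gr zr; rewrite fg subrr nz0.
by rewrite pmulr_rle0// divr_gt0.
Qed.

(** The norm topology is attached to the sort of a numFieldType; naming the
    structure makes it available on R[i]. *)
Definition cfield : numFieldType := R[i].

(** Every function whose limit at 0 is needed satisfies such a bound. *)
Lemma cvg_lipschitz (f : cfield -> cfield) (l : cfield) (K d : R) : 0 < d ->
  (forall z : C, normc z < d -> normc (f z - l : C) <= K * normc z) ->
  f z @[z --> (0 : cfield)] --> l.
Proof.
move=> d0 fP; apply: cvg_at0 => e e0.
have [e' eE] : exists e' : R, e = e'%:C.
  by apply/complex_realP; rewrite gtr0_real.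
move: e0; rewrite eE [_ < _]ltcR => e0.
have K0 : 0 < `|K| + 1 by have := normr_ge0 K; lra.
exists (Num.min d (e' / (`|K| + 1)))%:C.
  by rewrite [_ < _]ltcR lt_min d0 divr_gt0.
move=> z; rewrite [_ < _]ltcR lt_min => /andP[zd]; rewrite ltr_pdivlMr// => ze.
rewrite [_ < _]ltcR; apply: le_lt_trans (fP _ zd) _.
apply: le_lt_trans ze; have := ler_norm K; have := normc_ge0 z; nra.
Qed.

End LocalInverse.

(** * Upper triangular matrices *)

Definition utri (B : pzRingType) (x y w : B) : 'M[B]_2 :=
  \matrix_(i, j) if i == 0 then (if j == 0 then x else y)
                 else (if j == 0 then 0 else w).

Lemma matrix2P (B : Type) (M N : 'M[B]_2) :
  M 0 0 = N 0 0 -> M 0 1 = N 0 1 -> M 1 0 = N 1 0 -> M 1 1 = N 1 1 -> M = N.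
Proof.
move=> h00 h01 h10 h11; apply/matrixP.
have I2 (k : 'I_2) : k = 0 \/ k = 1.
  by case: k => -[|[|//]] k2; [left|right]; exact: val_inj.
by move=> i j; case: (I2 i) => ->; case: (I2 j) => ->.
Qed.

Lemma utri1 (B : pzRingType) : utri 1 0 1 = 1%:M :> 'M[B]_2.
Proof. by apply: matrix2P; rewrite !mxE. Qed.

Lemma utri_add (B : pzRingType) (x y w x' y' w' : B) :
  utri x y w + utri x' y' w' = utri (x + x') (y + y') (w + w').
Proof. by apply: matrix2P; rewrite !mxE //= addr0. Qed.

Lemma utri_mul (B : pzRingType) (x y w x' y' w' : B) :
  utri x y w *m utri x' y' w' = utri (x * x') (x * y' + y * w') (w * w').
Proof.
by apply: matrix2P; rewrite !mxE !big_ord_recl big_ord0 !mxE /=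
  ?mul0r ?mulr0 ?addr0 ?add0r.
Qed.

Lemma utri_inv (F : fieldType) (x y w : F) : x != 0 -> w != 0 ->
  utri x y w \in unitmx /\ invmx (utri x y w) = utri x^-1 (- (y / (x * w))) w^-1.
Proof.
move=> x0 w0.
have E : utri x y w *m utri x^-1 (- (y / (x * w))) w^-1 = 1%:M.
  rewrite utri_mul -utri1; congr utri; rewrite ?divff//.
  by field; rewrite ?x0 ?w0.
have /mulmx1_unit[uM _] := E; split=> //.
by rewrite -[LHS]mulmx1 -E mulKmx.
Qed.

(** With equal diagonal entries, conjugation only rescales the off-diagonal entry.
    This is why matrices with diagonal (z, z) are used: the diagonal at which the
    inner S-transform is evaluated does not move. *)
Lemma conj_utri (F : fieldType) (s h t z k : F) : s != 0 -> t != 0 ->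
  invmx (utri s h t) *m utri z k z *m utri s h t = utri z (k * t / s) z.
Proof.
move=> s0 t0; have [uS _] := utri_inv h s0 t0.
rewrite -mulmxA.
have -> : utri z k z *m utri s h t = utri s h t *m utri z (k * t / s) z.
  rewrite !utri_mul; congr utri; [exact: mulrC|by field|exact: mulrC].
by rewrite mulKmx.
Qed.

Lemma utri_upper (R : realType) (x y w : R[i]) : upper_triangular (utri x y w).
Proof.
by apply/is_trig_mxP => -[[|[|//]] i2] [[|[|//]] j2]//= _; rewrite !mxE.
Qed.

Lemma upper_utri (R : realType) (G : 'M[R[i]]_2) : upper_triangular G ->
  G = utri (G 0 0) (G 0 1) (G 1 1).
Proof.
by move=> /is_trig_mxP /(_ 0 1 isT); rewrite mxE => G10; apply: matrix2P; rewrite !mxE.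
Qed.

Lemma mxinvP (R : realType) (A : algType R[i]) n (M Y : 'M[A]_n) :
  Y *m M = 1%:M -> M *m Y = 1%:M -> mxinv M = Y.
Proof.
move=> YM MY; rewrite /mxinv; case: xgetP => [Y' _ [Y'M _]|/(_ Y)[]//].
by rewrite -[Y']mulmx1 -MY mulmxA Y'M mul1mx.
Qed.

Lemma Xmx_mul (R : realType) (A : algType R[i]) (a b a' b' : A) :
  Xmx a b *m Xmx a' b' = Xmx (a * a') (b * b').
Proof.
by apply: matrix2P; rewrite !mxE !big_ord_recl big_ord0 !mxE /=
  ?mulr1n ?mulr0n ?mulr0 ?mul0r ?addr0 ?add0r.
Qed.

(** * The transforms of a pair (a, b) *)

Section Transforms.
Variables (R : realType) (A : algType R[i]) (nrm : A -> R) (phi : {scalar A}).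
Hypothesis phiP : banach_functional nrm phi.
Local Notation C := R[i].
Implicit Types (a b c x y : A) (z w u v : C).

(** (1 - x)^-1, the sum of the geometric series of x. *)
Definition geom (x : A) : A :=
  xget 0 [set q | q * (1 - x) = 1 /\ (1 - x) * q = 1].

(** The generating series of the moments phi (a^m c b^n). All the functions occurring
    in the entries of S_X are of this form. *)
Definition res_moment a c b (u v : C) : C :=
  phi (geom (u *: a) * c * geom (v *: b)).

(** The scalar transform psi_a (u), the sum of u^n phi (a^n) over n >= 1. *)
Definition moment_series a (u : C) : C := phi (geom (u *: a)) - 1.

(** A disc on which 1 - u a is invertible. *)
Definition in_disc a (u : C) : Prop := normc u * nrm a <= 2^-1.

Lemma phiB x y : phi (x - y) = phi x - phi y. Proof. exact: raddfB. Qed.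

Lemma phiD x y : phi (x + y) = phi x + phi y. Proof. exact: raddfD. Qed.

Lemma phiZ z x : phi (z *: x) = z * phi x. Proof. exact: linearZ_LR. Qed.

Lemma geomP x q : q * (1 - x) = 1 -> (1 - x) * q = 1 -> geom x = q.
Proof.
move=> q1 q2; rewrite /geom; case: xgetP => [q' _ [q1' q2']|/(_ q)[]//].
by rewrite -[q']mulr1 -q2 mulrA q1' mul1r.
Qed.

Lemma geom0 : geom 0 = 1.
Proof. by apply: geomP; rewrite subr0 mulr1. Qed.

Lemma in_disc0 a : in_disc a 0.
Proof. by rewrite /in_disc [normc _]normc0 mul0r invr_ge0 ler0n. Qed.

Lemma in_disc_geom a u : in_disc a u ->
  [/\ geom (u *: a) * (1 - u *: a) = 1, (1 - u *: a) * geom (u *: a) = 1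
    & nrm (geom (u *: a)) <= 2].
Proof.
case: phiP => n0 _ nZ res _ su.
have [|q [q1 q2 qn]] := res (u *: a); first exact: le_trans (nZ _ _) su.
by rewrite (geomP q1 q2).
Qed.

Lemma geom_stepr a u : in_disc a u -> geom (u *: a) = 1 + u *: (geom (u *: a) * a).
Proof.
case/in_disc_geom => /eqP; rewrite mulrBr mulr1 subr_eq => /eqP h _ _.
by rewrite {1}h scalerAr.
Qed.

Lemma geom_stepl a u : in_disc a u -> geom (u *: a) = 1 + u *: (a * geom (u *: a)).
Proof.
case/in_disc_geom => _ /eqP; rewrite mulrBl mul1r subr_eq => /eqP h _.
by rewrite {1}h scalerAl.
Qed.

(** Both factors satisfy (1 - x)^-1 = 1 + O(x), by geom_stepr. *)
Lemma res_moment_estimate a c b u v : in_disc a u -> in_disc b v ->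
  normc (res_moment a c b u v - phi c) <=
  4 * nrm c * (nrm a * normc u + nrm b * normc v).
Proof.
move=> su sv; have [n0 nM nZ _ [phin _]] := phiP.
have [_ _ gu] := in_disc_geom su; have [_ _ gv] := in_disc_geom sv.
have -> : res_moment a c b u v - phi c =
    u * phi (geom (u *: a) * a * c * geom (v *: b)) + v * phi (c * (geom (v *: b) * b)).
  rewrite /res_moment -phiB {1}(geom_stepr su) !mulrDl mul1r.
  have -> : c * geom (v *: b) = c + v *: (c * (geom (v *: b) * b)).
    by rewrite {1}(geom_stepr sv) mulrDr mulr1 -scalerAr.
  rewrite addrAC [c + _]addrC addrK addrC -!scalerAl.
  by rewrite phiD !phiZ.
apply: le_trans (le_normcD _ _) _; rewrite !normcM.
have h1 : normc (phi (geom (u *: a) * a * c * geom (v *: b))) <= 4 * nrm c * nrm a.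
  apply: le_trans (phin _) _; apply: le_trans (nM _ _) _.
  have : nrm (geom (u *: a) * a * c) <= 2 * nrm a * nrm c.
    apply: le_trans (nM _ _) _; rewrite ler_wpM2r//.
    by apply: le_trans (nM _ _) _; rewrite ler_wpM2r.
  have := n0 (geom (v *: b)); have := n0 (geom (u *: a) * a * c).
  have : 0 <= nrm a * nrm c by rewrite mulr_ge0.
  by move: gv; nra.
have h2 : normc (phi (c * (geom (v *: b) * b))) <= 4 * nrm c * nrm b.
  apply: le_trans (phin _) _; apply: le_trans (nM _ _) _.
  have : nrm (geom (v *: b) * b) <= 2 * nrm b.
    by apply: le_trans (nM _ _) _; rewrite ler_wpM2r.
  have := n0 c; have := n0 b; nra.
have := normc_ge0 u; have := normc_ge0 v; nra.
Qed.

Lemma res_moment_neq0 a b : phi b != 0 ->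
  exists2 r : R, 0 < r & forall u v, normc u <= r -> normc v <= r ->
    [/\ in_disc a u, in_disc b v & res_moment a b b u v != 0].
Proof.
move=> /normc_gt0 pb0; have [n0 _ _ _ [phin _]] := phiP.
pose n := nrm a + nrm b; have na := n0 a.
have nb : normc (phi b) <= nrm b by exact: phin.
have nb0 : 0 < nrm b by lra.
have n_gt0 : 0 < n by rewrite /n; lra.
have n2 : 0 < 16 * n ^+ 2 by rewrite mulr_gt0// exprn_gt0.
pose r := normc (phi b) / (16 * n ^+ 2).
have rE : r * (16 * n ^+ 2) = normc (phi b) by rewrite divfK// gt_eqF.
have r0 : 0 < r by rewrite divr_gt0.
have rn : r * n <= 2^-1.
  rewrite -(ler_pM2r n_gt0); move: rE; rewrite expr2 /n; nra.
exists r => // u v ur vr.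
have su : in_disc a u.
  by rewrite /in_disc; move: rn; rewrite /n; have := normc_ge0 u; nra.
have sv : in_disc b v.
  by rewrite /in_disc; move: rn; rewrite /n; have := normc_ge0 v; nra.
split=> //; apply/negP => /eqP m0.
have := res_moment_estimate b su sv; rewrite m0 sub0r normcN; apply/negP.
rewrite -ltNge; apply: (@le_lt_trans _ _ (4 * n * (n * r))).
  have := normc_ge0 u; have := normc_ge0 v => v0 u0.
  have : nrm a * normc u + nrm b * normc v <= n * r by rewrite /n; nra.
  have : 0 <= n * r by rewrite mulr_ge0// ltW.
  have : nrm b <= n by rewrite /n; lra.
  by nra.
by move: rE; rewrite expr2; nra.
Qed.

Lemma res_moment_cvg a c b (f g : C -> C) (K d : R) : 0 < d ->
  (forall z, normc z < d -> in_disc a (f z) /\ normc (f z) <= K * normc z) ->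
  (forall z, normc z < d -> in_disc b (g z) /\ normc (g z) <= K * normc z) ->
  (res_moment a c b (f z) (g z) : cfield R) @[z --> (0 : cfield R)] -->
    (phi c : cfield R).
Proof.
move=> d0 fP gP; have [n0 _ _ _ _] := phiP.
apply: (@cvg_lipschitz R _ _ (4 * nrm c * (nrm a + nrm b) * K) d) => // z zd.
have [sf fK] := fP z zd; have [sg gK] := gP z zd.
apply: le_trans (res_moment_estimate c sf sg) _.
rewrite -[X in _ <= X]mulrA -[X in _ <= X]mulrA ler_wpM2l ?mulr_ge0//.
by have := n0 a; have := n0 b; nra.
Qed.

(** The resolvent identity. Its right-hand factor is close to phi a near 0, so psi_a is
    nearly linear there, with slope phi a. *)
Lemma moment_series_sub a z w : in_disc a z -> in_disc a w ->
  moment_series a z - moment_series a w = (z - w) * res_moment a a a z w.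
Proof.
move=> sz sw; have [z1 z2 _] := in_disc_geom sz; have [w1 w2 _] := in_disc_geom sw.
rewrite /moment_series opprB addrA subrK -phiB /res_moment -phiZ; congr (phi _).
have -> : geom (z *: a) - geom (w *: a) =
    geom (z *: a) * ((1 - w *: a) - (1 - z *: a)) * geom (w *: a).
  by rewrite mulrBr mulrBl z1 mul1r -mulrA w2 mulr1.
have -> : (1 - w *: a) - (1 - z *: a) = (z - w) *: a.
  by rewrite opprB addrC addrA subrK scalerBl.
by rewrite -scalerAr -scalerAl.
Qed.

Lemma moment_series_0 a : moment_series a 0 = 0.
Proof.
by case: phiP => _ _ _ _ [_ p1]; rewrite /moment_series scale0r geom0 p1 subrr.
Qed.

Lemma moment_seriesE a u : in_disc a u -> moment_series a u = u * res_moment a a 0 u 0.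
Proof.
case: phiP => _ _ _ _ [_ p1] su.
by rewrite /moment_series {1}(geom_stepr su) phiD phiZ p1 addrC addKr /res_moment
  scale0r geom0 mulr1.
Qed.

Lemma moment_seriesEl b v : in_disc b v -> moment_series b v = v * res_moment 0 b b 0 v.
Proof.
case: (phiP) => _ _ _ _ [_ p1] sv.
by rewrite /moment_series {1}(geom_stepl sv) phiD phiZ p1 [1 + _]addrC addrK /res_moment
  scale0r geom0 mul1r.
Qed.

Lemma moment_series_bound a z : in_disc a z ->
  normc (moment_series a z) <= 3 * nrm a * normc z.
Proof.
move=> sz; have [n0 _ _ _ [phin _]] := phiP.
have := res_moment_estimate a sz (in_disc0 0).
rewrite [normc 0]normc0 mulr0 addr0 => h.
have [ND _ _ _] := normc_complete R.
have := ND (res_moment a a 0 z 0 - phi a) (phi a); rewrite subrK => h2.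
have : normc (res_moment a a 0 z 0) <= 3 * nrm a.
  by have := phin a; have := n0 a; move: (sz : normc z * nrm a <= 2^-1); nra.
by rewrite (moment_seriesE sz) normcM; have := normc_ge0 z; nra.
Qed.

(** By moment_series_sub and res_moment_estimate the relative error in the linear
    approximation of psi_a on the ball of radius r is at most 8 |a|^2 r / |phi a|;
    the radius |phi a| / (16 |a|^2) makes it 1/2. *)
Lemma moment_series_inverse a : phi a != 0 ->
  exists (f : C -> C) (d : R), 0 < d /\
    (forall y : C, normc y <= d -> [/\ moment_series a (f y) = y, in_disc a (f y)
       & normc (f y) <= 2 / normc (phi a) * normc y]) /\
    (forall z, normc z <= d -> normc (moment_series a z) <= d ->
       f (moment_series a z) = z).
Proof.
move=> pa0; have [n0 _ _ _ [phin _]] := phiP.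
have pa := normc_gt0 pa0.
have na := phin a; have na0 : 0 < nrm a by exact: lt_le_trans na.
pose r := normc (phi a) / (16 * nrm a ^+ 2).
have r0 : 0 < r by rewrite divr_gt0// mulr_gt0// exprn_gt0.
have rE : r * (16 * nrm a ^+ 2) = normc (phi a).
  by rewrite divfK// gt_eqF// mulr_gt0// exprn_gt0.
have sr z : normc z <= r -> in_disc a z.
  by move=> zr; rewrite /in_disc; nra.
have [||z w zr wr|f [f1 f2]] := @local_inverse R (moment_series a) (phi a) r pa0.
- exact: ltW.
- exact: moment_series_0.
- have sz := sr _ zr; have sw := sr _ wr.
  rewrite moment_series_sub// [phi a * _]mulrC -mulrBr normcM mulrC.
  rewrite ler_wpM2r ?normc_ge0//.
  apply: le_trans (res_moment_estimate _ sz sw) _; nra.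
pose d := Num.min r (normc (phi a) * r / 2).
exists f, d; split; first by rewrite lt_min r0 divr_gt0// mulr_gt0.
split=> [y|z]; rewrite !le_min => /andP[h1 h2]; last by move=> /andP[_]; exact: f2.
have [fy fyn] := f1 _ h2; split=> //.
  apply: sr; apply: le_trans fyn _; rewrite ler_pdivrMr//; lra.
by apply: le_trans fyn _; lra.
Qed.

(** The inverse of an upper triangular matrix over a noncommutative ring is again
    upper triangular, with entries that can be written down. *)
Lemma Psi_utri a b u h v : in_disc a u -> in_disc b v ->
  Psi phi (Xmx a b) (utri u h v) =
  utri (moment_series a u) (h * res_moment a b b u v) (moment_series b v).
Proof.
move=> su sv; have [u1 u2 _] := in_disc_geom su.
have [v1 v2 _] := in_disc_geom sv.
have MX : 1%:M - map_mx (in_alg A) (utri u h v) *m Xmx a b =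
    utri (1 - u *: a) (- (h *: b)) (1 - v *: b).
  by apply: matrix2P; rewrite !mxE !big_ord_recl big_ord0 !mxE /= ?mulr1n
    ?mulr0n ?mulr0 ?addr0 ?add0r ?mul0r ?scale0r ?mul0r ?mulr_algl ?sub0r ?oppr0.
rewrite /Psi MX (mxinvP (Y := utri (geom (u *: a))
    (h *: (geom (u *: a) * b * geom (v *: b))) (geom (v *: b)))); last 2 first.
- rewrite utri_mul u1 v1 -utri1; congr utri.
  by rewrite mulrN -scalerAl -!mulrA v1 mulr1 scalerAr addNr.
- rewrite utri_mul u2 v2 -utri1; congr utri.
  by rewrite mulNr -scalerAr !mulrA u2 mul1r -scalerAl subrr.
apply: matrix2P; rewrite !mxE //= ?subr0 ?subrr//.
  exact: phiZ.
exact: raddf0.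
Qed.

(** Psi acts diagonally by psi_a and psi_b and multiplies the off-diagonal entry by a
    factor that is nonzero near 0, hence it has a composition inverse F. The chosen
    inverse Psi_inv agrees with F near 0: the diagonal of F G is small with that of G,
    and Psi_inv (Psi (F G)) = F G. The functions f and g, which invert psi_a and
    psi_b, do not depend on the off-diagonal entry. *)
Lemma Psi_inv_utri a b : phi a != 0 -> phi b != 0 ->
  exists (f g : C -> C) (K d : R), [/\ 0 < K, 0 < d,
    forall z, normc z < d ->
      [/\ in_disc a (f z), moment_series a (f z) = z & normc (f z) <= K * normc z],
    forall w, normc w < d ->
      [/\ in_disc b (g w), moment_series b (g w) = w & normc (g w) <= K * normc w]
    & forall z w h, normc z < d -> normc w < d ->
      res_moment a b b (f z) (g w) != 0 /\
      Psi_inv phi (Xmx a b) (utri z h w) =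
        utri (f z) (h / res_moment a b b (f z) (g w)) (g w)].
Proof.
move=> pa pb; have [n0 _ _ _ _] := phiP; have na0 := n0 a; have nb0 := n0 b.
have [f [d1 [d10 [f1 f2]]]] := moment_series_inverse pa.
have [g [d2 [d20 [g1 g2]]]] := moment_series_inverse pb.
have [r r0 rP] := res_moment_neq0 a pb.
have pa0 := normc_gt0 pa; have pb0 := normc_gt0 pb.
pose Ka := 2 / normc (phi a); pose Kb := 2 / normc (phi b); pose K := Ka + Kb.
have Ka0 : 0 < Ka by rewrite divr_gt0.
have Kb0 : 0 < Kb by rewrite divr_gt0.
have K0 : 0 < K by rewrite addr_gt0.
have fK z : normc z <= d1 -> normc (f z) <= K * normc z.
  case/f1 => _ _ h; apply: le_trans h _.
  by rewrite ler_wpM2r ?normc_ge0// /K -/Ka; lra.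
have gK z : normc z <= d2 -> normc (g z) <= K * normc z.
  case/g1 => _ _ h; apply: le_trans h _.
  by rewrite ler_wpM2r ?normc_ge0// /K -/Kb; lra.
pose n := 3 * (nrm a + nrm b) + 1.
have n_gt0 : 0 < n by rewrite /n; lra.
pose d0 := Num.min (Num.min d1 d2)
  (Num.min (Num.min r (r / K)) (Num.min (d1 / n) (d2 / n))).
have d00 : 0 < d0 by rewrite !lt_min d10 d20 r0 !divr_gt0.
have d0P z : normc z < d0 -> [/\ normc z <= d1, normc z <= d2, normc z <= r,
    K * normc z <= r & n * normc z <= d1 /\ n * normc z <= d2].
  rewrite !lt_min => /andP[/andP[/ltW-> /ltW->] /andP[/andP[/ltW-> +] /andP[]]].
  rewrite !ltr_pdivlMr// ![_ * K]mulrC ![_ * n]mulrC.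
  by move=> /ltW-> /ltW-> /ltW->.
pose F (G : 'M[C]_2) := utri (f (G 0 0))
  (G 0 1 / res_moment a b b (f (G 0 0)) (g (G 1 1))) (g (G 1 1)).
have FE z h w : F (utri z h w) = utri (f z) (h / res_moment a b b (f z) (g w)) (g w).
  by rewrite /F !mxE.
have mfg z w : normc z < d0 -> normc w < d0 -> res_moment a b b (f z) (g w) != 0.
  move=> /d0P[z1 _ _ z3 _] /d0P[_ w2 _ w3 _].
  have [] // := rP (f z) (g w).
    exact: le_trans (fK _ z1) _.
  exact: le_trans (gK _ w2) _.
have PsiF z h w : normc z < d0 -> normc w < d0 ->
    Psi phi (Xmx a b) (F (utri z h w)) = utri z h w.
  move=> zd wd; have m0 := mfg _ _ zd wd.
  have [/f1[fz sfz _] _ _ _ _] := d0P _ zd.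
  have [_ /g1[gw sgw _] _ _ _] := d0P _ wd.
  by rewrite FE Psi_utri// fz gw divfK.
(* The bounds n |z| <= d1 and n |w| <= d2 say that psi_a z and psi_b w are in the
   domains on which f and g are known to be inverses. *)
have compF : comp_inverse_of (Psi phi (Xmx a b)) F.
  exists d0 => // G /upper_utri ->; rewrite !mxE /= !ltcR => zd wd.
  split; [exact: utri_upper|exact: PsiF|].
  have [z1 _ zr _ [zn _]] := d0P _ zd; have [_ w2 wr _ [_ wn]] := d0P _ wd.
  have [sz sw m0] := rP _ _ zr wr.
  rewrite Psi_utri// FE f2//; last first.
    apply: le_trans (moment_series_bound sz) _; apply: le_trans zn.
    by rewrite ler_wpM2r ?normc_ge0// /n; lra.
  rewrite g2//; last first.
    apply: le_trans (moment_series_bound sw) _; apply: le_trans wn.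
    by rewrite ler_wpM2r ?normc_ge0// /n; lra.
  by rewrite mulfK.
have [d' d'0 invP] : comp_inverse_of (Psi phi (Xmx a b)) (Psi_inv phi (Xmx a b)).
  by rewrite /Psi_inv; case: xgetP => [Y _ //|/(_ F)].
exists f, g, K, (Num.min d0 (d' / K)); split=> //.
- by rewrite lt_min d00 divr_gt0.
- move=> z; rewrite lt_min => /andP[/d0P[z1 _ _ _ _] _].
  by split; [case: (f1 _ z1)..|exact: fK].
- move=> z; rewrite lt_min => /andP[/d0P[_ z1 _ _ _] _].
  by split; [case: (g1 _ z1)..|exact: gK].
- move=> z w h; rewrite (lt_min (normc z)) (lt_min (normc w)).
  rewrite !ltr_pdivlMr// ![_ * K]mulrC.
  move=> /andP[zd zd'] /andP[wd wd']; split; first exact: mfg.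
  have [z1 _ _ _ _] := d0P _ zd; have [_ w2 _ _ _] := d0P _ wd.
  rewrite -FE -[in LHS](PsiF _ h)//.
  have [|||_ _ ->] // := invP (F (utri z h w)).
  + exact: utri_upper.
  + rewrite FE !mxE /= normcE_real ltcR; exact: le_lt_trans (fK _ z1) _.
  + rewrite FE !mxE /= normcE_real ltcR; exact: le_lt_trans (gK _ w2) _.
Qed.

(** Put u = f z, v = g z, so that z = u ga = v gb by definition of f and g. With
    h1 = gb + u gab, the off-diagonal entry of (1 + G^-1) Psi_inv (G), divided by that
    of G, is (1 + z) / (z h1) - v / z^2 = (ga gb - gab) / (ga h1 gb): the singular factor
    1 / z cancels. In the limit ga, gb, h1, gab become phi a, phi b, phi b, phi (a b). *)
Lemma S_transform_limit a b : phi a != 0 -> phi b != 0 ->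
  exists (s m t : cfield R -> cfield R) (d : R), [/\ 0 < d,
    s z @[z --> (0 : cfield R)] --> ((phi a)^-1 : cfield R),
    m z @[z --> (0 : cfield R)] -->
      ((phi a * phi b - phi (a * b)) / (phi a * phi b * phi b) : cfield R),
    t z @[z --> (0 : cfield R)] --> ((phi b)^-1 : cfield R)
    & forall z h : C, z != 0 -> normc z < d ->
      S_transform phi (Xmx a b) (utri z h z) = utri (s z : C) (h * (m z : C)) (t z)
      /\ (s z : C) != 0 /\ (t z : C) != 0].
Proof.
move=> pa pb; have [f [g [K [d [K0 d0 fP gP SP]]]]] := Psi_inv_utri pa pb.
pose ga z := res_moment a a 0 (f z) 0.
pose gb z := res_moment 0 b b 0 (g z).
pose h1 z := res_moment a b b (f z) (g z).
pose gab z := res_moment a (a * b) b (f z) (g z).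
have fs z : normc z < d -> in_disc a (f z) /\ normc (f z) <= K * normc z.
  by move=> /fP[].
have gs z : normc z < d -> in_disc b (g z) /\ normc (g z) <= K * normc z.
  by move=> /gP[].
have zs z : normc z < d -> in_disc 0 0 /\ normc (0 : C) <= K * normc z.
  split; first exact: in_disc0.
  by rewrite [normc 0]normc0 mulr_ge0 ?normc_ge0// ltW.
have cga := res_moment_cvg (c := a) d0 fs zs.
have cgb := res_moment_cvg (c := b) d0 zs gs.
have ch := res_moment_cvg (c := b) d0 fs gs.
have cm := res_moment_cvg (c := a * b) d0 fs gs.
have c1 : ((1 + z : cfield R) @[z --> (0 : cfield R)] --> (1 : cfield R)).
  apply: (@cvg_lipschitz R _ _ 1 d) => // z _.
  by rewrite [_ - _]addrAC subrr add0r mul1r.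
have [cs co ct] := S_entries_cvg pa pb c1 cga cgb ch cm.
eexists _, _, _, (Num.min d 1); split; [|exact: cs|exact: co|exact: ct|].
  by rewrite lt_min d0 ltr01.
move=> z h z0; rewrite lt_min => /andP[zd z_lt1].
have [sf fz _] := fP z zd; have [sg gz _] := gP z zd.
have [h10 PE] := SP z z h zd zd.
have zfa : z = f z * ga z by rewrite -{1}fz moment_seriesE.
have zgb : z = g z * gb z by rewrite -{1}gz (moment_seriesEl sg).
have h1E : h1 z = gb z + f z * gab z.
  rewrite /h1 /gb /gab /res_moment {1}(geom_stepr sf) scale0r geom0 mul1r.
  by rewrite !mulrDl mul1r phiD -!scalerAl phiZ !mulrA.
have /andP[f0 ga0] : (f z != 0) && (ga z != 0) by rewrite -negb_or -mulf_eq0 -zfa.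
have /andP[g0 gb0] : (g z != 0) && (gb z != 0) by rewrite -negb_or -mulf_eq0 -zgb.
have z1 : 1 + z != 0.
  apply/negP => /eqP/(canRL (addKr _)); rewrite addr0 => zN1; move: z_lt1.
  by rewrite zN1 normcN [normc _]normc1 ltxx.
rewrite /S_transform PE -utri1 utri_add add0r; have [_ ->] := utri_inv h z0 z0.
rewrite !utri_mul -/(h1 z); split; last by rewrite !mulf_neq0 ?invr_eq0.
have gE : g z = z / gb z by rewrite {2}zgb mulfK.
have fE : f z = z / ga z by rewrite {2}zfa mulfK.
have mE : gab z = (h1 z - gb z) * ga z / z.
  by rewrite h1E fE; field; rewrite z0 ga0.
transitivity (utri ((1 + z) / ga z)
  (h * ((ga z * gb z - gab z) / (ga z * h1 z * gb z))) ((1 + z) / gb z)); last by [].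
congr utri; last 1 first.
- by rewrite gE; field; rewrite z0 gb0.
- by rewrite fE; field; rewrite z0 ga0.
by rewrite mE gE; field; rewrite z0 ga0 gb0 h10.
Qed.

End Transforms.

(** * Moments of bi-free pairs *)

Section FreeProductMoments.
Variables (C : fieldType) (I : eqType) (V : I -> lmodType C).
Variables (T S : forall i, {linear pointed_space V i -> pointed_space V i}).

(** A multilinear form vanishes on a word with a zero letter. *)
Lemma tens_letter0 i (u v : word V) :
  Defs.alternating (u ++ mkletter (0 : V i) :: v) ->
  tens (u ++ mkletter (0 : V i) :: v) = 0.
Proof.
move=> al; apply: free_eq => f; rewrite tensE//.
by have := svalP f u v i 0 0 (-1) al; rewrite scaler0 add0r mulN1r addNr => ->.
Qed.

Lemma in_right_alt i w (x : V i) : in_right i w ->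
  Defs.alternating (rcons w (mkletter x)).
Proof.
move=> wi; rewrite -alternating_rev rev_rcons; apply: in_left_alt.
by move: wi; rewrite /in_left alternating_rev.
Qed.

(** The vector xi_i of X_i acts as the empty word: in this form lambda_i can be
    evaluated on any word that does not start in X_i. *)
Lemma tens_Vmap i w : in_left i w -> tens w = Vmap ((1, 0) : pointed_space V i) w.
Proof.
move=> wi; rewrite /Vmap scale1r (@tens_letter0 _ [::]) ?addr0//.
exact: in_left_alt.
Qed.

Lemma tens_Wmap i w : in_right i w -> tens w = Wmap w ((1, 0) : pointed_space V i).
Proof.
move=> wi; rewrite /Wmap scale1r -cats1 tens_letter0 ?addr0// cats1.
exact: in_right_alt.
Qed.

(** In Vmap and Wmap the first component is a scalar of the regular module C^o. Stated
    over C, the same equations can be rewritten with the laws of a C-module. *)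
Lemma VmapE i (x : pointed_space V i) w :
  Vmap x w = (x.1 : C) *: tens w + tens (mkletter x.2 :: w).
Proof. by []. Qed.

Lemma WmapE i (x : pointed_space V i) w :
  Wmap w x = (x.1 : C) *: tens w + tens (rcons w (mkletter x.2)).
Proof. by []. Qed.

Lemma psi_linear c (g h : free_product V) : psi (c *: g + h) = c * psi g + psi h.
Proof. by []. Qed.

Lemma psi_word (w : word V) : Defs.alternating w ->
  psi (tens w : free_product V) = (nilp w)%:R.
Proof. by case: w => [_|x w /psi_tens//]; exact: psi_xi. Qed.

Lemma psi_Vmap i w (x : pointed_space V i) : in_left i w ->
  psi (Vmap x w) = x.1 * (nilp w)%:R.
Proof.
move=> wi; have /andP[aw _] := wi.
by rewrite psi_linear !psi_word ?in_left_alt// addr0.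
Qed.

Lemma psi_Wmap i w (x : pointed_space V i) : in_right i w ->
  psi (Wmap w x) = x.1 * (nilp w)%:R.
Proof.
move=> wi; have /andP[aw _] := wi.
by rewrite psi_linear !psi_word ?in_right_alt// /nilp size_rcons addr0.
Qed.

Lemma lambda_tens i w : in_left i w -> lambda (T i) (tens w) = Vmap (T i (1, 0)) w.
Proof. by move=> wi; rewrite (tens_Vmap wi); case: (lambdaP (T i)) => _ ->. Qed.

Lemma rho_tens i w : in_right i w -> rho (S i) (tens w) = Wmap w (S i (1, 0)).
Proof. by move=> wi; rewrite (tens_Wmap wi); case: (rhoP (S i)) => _ ->. Qed.

Lemma psi_lambda i : psi (lambda (T i) (xi V)) = (T i (1, 0)).1.
Proof. by rewrite lambda_tens// psi_Vmap// mulr1. Qed.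

Lemma psi_rho i : psi (rho (S i) (xi V)) = (S i (1, 0)).1.
Proof. by rewrite rho_tens// psi_Wmap// mulr1. Qed.

Lemma psi_lambda_rho i :
  psi (lambda (T i) (rho (S i) (xi V))) = (T i (S i (1, 0))).1.
Proof.
rewrite rho_tens// -[Wmap _ _]/(Vmap (S i (1, 0)) [::]).
by case: (lambdaP (T i)) => _ ->//; rewrite psi_Vmap// mulr1.
Qed.

Lemma psi_lambda2 i j : i != j ->
  psi (lambda (T i) (lambda (T j) (xi V))) = (T i (1, 0)).1 * (T j (1, 0)).1.
Proof.
move=> ij; have [Ll _] := lambdaP (T i).
have il : in_left i [:: mkletter (T j (1, 0)).2] by rewrite /in_left /= eq_sym.
rewrite lambda_tens// /Vmap Ll psi_linear !lambda_tens// !psi_Vmap//.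
by rewrite mulr1 mulr0 addr0 mulrC.
Qed.

Lemma psi_rho2 i j : i != j ->
  psi (rho (S i) (rho (S j) (xi V))) = (S i (1, 0)).1 * (S j (1, 0)).1.
Proof.
move=> ij; have [Ll _] := rhoP (S i).
have il : in_right i [:: mkletter (S j (1, 0)).2] by rewrite /in_right /= eq_sym.
rewrite rho_tens// /Wmap Ll psi_linear !rho_tens// !psi_Wmap//.
by rewrite mulr1 mulr0 addr0 mulrC.
Qed.

(** The two right operators build the word y_j y_i from the right, whereas the left
    operators first meet y_j and only then y_i. Thus T_j acts on the vector
    q_j = S_j xi_j and T_i on q_i = S_i xi_i, as if the pairs acted separately; all
    words which remain nonempty are killed by psi. *)
Lemma psi_lambda2_rho2 i j : i != j ->
  psi (lambda (T i) (lambda (T j) (rho (S i) (rho (S j) (xi V))))) =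
  (T i (S i (1, 0))).1 * (T j (S j (1, 0))).1.
Proof.
move=> ij; have [Li LiV] := lambdaP (T i); have [Lj LjV] := lambdaP (T j).
have [Ri _] := rhoP (S i).
set qi := S i (1, 0); set qj := S j (1, 0); set r := T j qj.
have irj (y : V j) : in_right i [:: mkletter y] by rewrite /in_right /= eq_sym.
have ilj (y : V j) : in_left i [:: mkletter y] by rewrite /in_left /= eq_sym.
have jli (y : V i) : in_left j [:: mkletter y] by rewrite /in_left /=.
have ilji (y : V j) (z : V i) : in_left i [:: mkletter y; mkletter z].
  by rewrite /in_left /= eq_sym ij.
have regroup (c d : C) (x y z t : free_product V) :
    c *: (d *: x + y) + (d *: z + t) = d *: (c *: x + z) + (c *: y + t).
  by rewrite !scalerDr !scalerA mulrC addrACA.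
(* T_j acts from the left, so the vector is written with q_j in front. *)
have -> : rho (S i) (rho (S j) (xi V)) =
    (qi.1 : C) *: Vmap qj [::] + Vmap qj [:: mkletter qi.2].
  by rewrite rho_tens// WmapE Ri !rho_tens ?VmapE ?WmapE //; exact: irj.
have -> : lambda (T j) ((qi.1 : C) *: Vmap qj [::] + Vmap qj [:: mkletter qi.2]) =
    (r.1 : C) *: Vmap qi [::] + ((qi.1 : C) *: tens [:: mkletter r.2] +
                                 tens [:: mkletter r.2; mkletter qi.2]).
  by rewrite Lj !LjV// !VmapE -/r [LHS]regroup addrA.
rewrite Li LiV// Li !lambda_tens// (psi_linear r.1) (psi_linear qi.1) !psi_Vmap//.
by rewrite !mulr0 mulr1 !addr0 mulrC.
Qed.

End FreeProductMoments.

(** The last identity holds as if a_j commuted with b_i, after which the pairs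
    (a_i, b_i) and (a_j, b_j) factor. *)
Lemma bifree_moments (C : fieldType) (I : eqType) (A : algType C)
    (phi : A -> C) (a b : I -> A) (i j : I) : bifree phi a b -> i != j ->
  [/\ phi (a i * a j) = phi (a i) * phi (a j),
      phi (b i * b j) = phi (b i) * phi (b j)
    & phi ((a i * a j) * (b i * b j)) = phi (a i * b i) * phi (a j * b j)].
Proof.
move=> [V [T [S bf]]] ij.
have moment (s : seq (I + I)) :
    phi (\prod_(k <- s) match k with inl i => a i | inr i => b i end) =
    psi (foldr (fun k => match k with
                         | inl i => lambda (T i)
                         | inr i => rho (S i) end) (xi V) s).
  have := bf [:: (1, s)].
  by rewrite /nceval /ncact !big_seq1 !scale1r.
have la k : phi (a k) = (T k (1, 0)).1.
  by have := moment [:: inl k]; rewrite big_seq1 /= psi_lambda.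
have rb k : phi (b k) = (S k (1, 0)).1.
  by have := moment [:: inr k]; rewrite big_seq1 /= psi_rho.
have lr k : phi (a k * b k) = (T k (S k (1, 0))).1.
  by have := moment [:: inl k; inr k]; rewrite big_cons big_seq1 /= psi_lambda_rho.
split.
- have := moment [:: inl i; inl j]; rewrite big_cons big_seq1 /= psi_lambda2//.
  by rewrite !la.
- have := moment [:: inr i; inr j]; rewrite big_cons big_seq1 /= psi_rho2//.
  by rewrite !rb.
- have := moment [:: inl i; inl j; inr i; inr j].
  by rewrite !big_cons big_nil /= psi_lambda2_rho2// mulr1 !lr mulrA.
Qed.

(** * Failure of multiplicativity *)

Theorem corollary2p5 (R : realType) (H : hilbertSpace R) (A : algType R[i])
    (rep : A -> H -> H) (phi : {scalar A}) (a b : 'I_2 -> A) :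
  von_neumann_rep rep ->
  is_state rep phi ->
  bifree phi a b ->
  (forall j, phi (a j * b j) <> phi (a j) * phi (b j)) ->
  (forall j, phi (a j) <> 0 /\ phi (b j) <> 0) ->
  let X (j : 'I_2) : 'M[A]_2 := Xmx (a j) (b j) in
  forall eps : R, 0 < eps ->
  exists G : 'M[R[i]]_2,
    [/\ upper_triangular G, G \in unitmx, `|G| < eps%:C &
      S_transform phi (X 0 *m X 1) G <>
      S_transform phi (X 1) G *m
      S_transform phi (X 0)
        (invmx (S_transform phi (X 1) G) *m G *m S_transform phi (X 1) G)].
Proof.
move=> repP stP bf cor ne0 X eps eps0.
have phiP := state_banach_functional repP stP.
have [a0 b0] : phi (a 0) != 0 /\ phi (b 0) != 0.
  by case: (ne0 0) => /eqP ? /eqP.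
have [a1 b1] : phi (a 1) != 0 /\ phi (b 1) != 0.
  by case: (ne0 1) => /eqP ? /eqP.
have [aM bM abM] := bifree_moments bf (isT : (0 : 'I_2) != 1).
have [||s [m [t [d [d_gt0 _ cm _ SE]]]]] :=
    S_transform_limit phiP (a := a 0 * a 1) (b := b 0 * b 1).
- by rewrite aM mulf_neq0.
- by rewrite bM mulf_neq0.
have [s0 [m0 [t0 [d0 [d0_gt0 _ cm0 ct0 S0E]]]]] := S_transform_limit phiP a0 b0.
have [s1 [m1 [t1 [d1 [d1_gt0 _ cm1 ct1 S1E]]]]] := S_transform_limit phiP a1 b1.
pose U : 'M[R[i]]_2 := utri 1 1 1.
apply: contrapT => noG.
(* The off-diagonal entries of the two sides at z U, after division by z. *)
have same (z : R[i]) : z != 0 -> normc z < d -> normc z < d0 -> normc z < d1 ->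
    `|z *: U| < eps%:C -> (m z : R[i]) = t1 z * m0 z + t0 z * m1 z.
  move=> z0 zd zd0 zd1 zeps.
  have zU : z *: U = utri z z z.
    by apply: matrix2P; rewrite !mxE /= ?mulr1 ?mulr0.
  rewrite zU in zeps.
  have [SG _] := SE z z z0 zd; have [S1G [s1n t1n]] := S1E z z z0 zd1.
  have [S0G _] := S0E z (z * t1 z / s1 z) z0 zd0.
  have [zu _] := utri_inv z z0 z0.
  have eqS : S_transform phi (X 0 *m X 1) (utri z z z) =
      S_transform phi (X 1) (utri z z z) *m S_transform phi (X 0)
        (invmx (S_transform phi (X 1) (utri z z z)) *m utri z z z *m
         S_transform phi (X 1) (utri z z z)).
    apply: contrapT => neS; apply: noG; exists (utri z z z); split=> //.
    exact: utri_upper.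
  move: eqS; rewrite Xmx_mul SG S1G conj_utri// S0G utri_mul.
  move=> /matrixP /(_ 0 1); rewrite !mxE /= => E.
  apply: (mulfI z0); rewrite E; field; exact: s1n.
have [e e_gt0 eU] : exists2 e : R, 0 < e & forall z : R[i], normc z < e ->
    `|z *: U| < eps%:C.
  have epsC : 0 < eps%:C :> cfield R by rewrite [_ < _]ltcR.
  have [e' e'0 e'U] := @scale_small (cfield R) 1 1 U _ epsC.
  have [e eE] : exists e : R, e' = e%:C.
    by apply/complex_realP; rewrite gtr0_real.
  move: e'0 e'U; rewrite eE [_ < _]ltcR => e_gt0 eU; exists e => // z ze.
  by apply: eU; rewrite [_ < _]ltcR.
have D_gt0 : 0 < (Num.min (Num.min d e) (Num.min d0 d1))%:C :> cfield R.
  by rewrite [_ < _]ltcR !lt_min d_gt0 e_gt0 d0_gt0 d1_gt0.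
have := cvg_relation cm cm0 cm1 ct0 ct1 D_gt0.
rewrite aM bM abM => lim; suff : (phi (a 0 * b 0) - phi (a 0) * phi (b 0)) *
    (phi (a 1 * b 1) - phi (a 1) * phi (b 1)) = 0 :> R[i].
  by move/eqP; rewrite mulf_eq0 !subr_eq0 => /orP[] /eqP; exact: cor.
(* This is k = k0 + k1, divided by - phi (b 0) phi (b 1). *)
have {}lim : (phi (a 0) * phi (a 1) * (phi (b 0) * phi (b 1)) -
      phi (a 0 * b 0) * phi (a 1 * b 1)) /
      (phi (a 0) * phi (a 1) * (phi (b 0) * phi (b 1)) * (phi (b 0) * phi (b 1))) =
    (phi (b 1))^-1 * ((phi (a 0) * phi (b 0) - phi (a 0 * b 0)) /
      (phi (a 0) * phi (b 0) * phi (b 0))) +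
    (phi (b 0))^-1 * ((phi (a 1) * phi (b 1) - phi (a 1 * b 1)) /
      (phi (a 1) * phi (b 1) * phi (b 1))) :> R[i].
  apply: lim => z z0.
  rewrite [_ < _]ltcR !lt_min => /andP[/andP[zd ze] /andP[zd0 zd1]].
  by apply: same => //; exact: eU.
move: a0 a1 b0 b1 lim.
move: (phi (a 0)) (phi (a 1)) (phi (b 0)) (phi (b 1)).
move: (phi (a 0 * b 0)) (phi (a 1 * b 1)) => g0 g1 x0 x1 y0 y1 x0n x1n y0n y1n.
move/(congr1 ( *%R (x0 * x1 * (y0 * y1) * (y0 * y1)))).
rewrite [X in _ = X -> _](_ : _ =
  (x0 * y0 - g0) * (x1 * y1) + (x1 * y1 - g1) * (x0 * y0)); last first.
  by field; rewrite x0n x1n y0n y1n.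
rewrite mulrC divfK ?mulf_neq0// => E.
rewrite (_ : _ * _ = (x0 * y0 - g0) * (x1 * y1) + (x1 * y1 - g1) * (x0 * y0) -
  (x0 * x1 * (y0 * y1) - g0 * g1)); last by ring.
by rewrite E subrr.
Qed.
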